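(* Let $Y$ be a real Banach space with property quasi-$\beta$. Then $\mathrm{BS}_a(c_0,Y)$ is norm-dense in $\mathcal{L}(c_0,Y)$. In particular, $\mathrm{BS}_a(c_0,c_0)$ is norm-dense in $\mathcal{L}(c_0,c_0)$.
   Context: All Banach spaces are real. $S_X$ and $B_X$ are the unit sphere and closed unit ball of $X$, and $\mathcal{L}(X,Y)$ is the space of bounded linear operators from $X$ to $Y$ with the operator norm. For $T\in\mathcal{L}(X,Y)$ put $M_T=\{x\in S_X:\|Tx\|=\|T\|\}$; $T$ attains its norm if $M_T\neq\emptyset$, and $\mathrm{NA}(X,Y)$ is the set of norm attaining operators. For vectors $x,y$ of a Banach space: $x\perp_B y$ means $\|x\|\le\|x+\lambda y\|$ for all $\lambda\in\mathbb{R}$; $x\perp_S y$ means $\|x\|<\|x+\lambda y\|$ for all $\lambda\in\mathbb{R}\setminus\{0\}$. $\mathrm{BS}_a(X,Y)$ (operators with the adjusted Bhatia-Šemrl property) is the set of $T\in\mathrm{NA}(X,Y)$ such that for every $S\in\mathcal{L}(X,Y)$ with $T\perp_S S$ there is $x_0\in M_T$ with $Tx_0\perp_B Sx_0$. A Banach space $Y$ has property quasi-$\beta$ if there are a set $A\subseteq S_{Y^*}$, a map $\sigma:A\to S_Y$ and a function $\rho:A\to\mathbb{R}$ such that: (i) $y^*(\sigma(y^* ))=1$ for every $y^*\in A$; (ii) $|z^*(\sigma(y^* ))|\le\rho(y^* )<1$ whenever $y^*,z^*\in A$, $y^*\ne z^*$; (iii) for every extreme point $e^*$ of $B_{Y^*}$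 there are a subset $A_{e^*}\subseteq A$ and a scalar $t$ with $|t|=1$ such that $te^*$ lies in the weak-$*$ closure of $A_{e^*}$ and $\sup\{\rho(y^* ):y^*\in A_{e^*}\}<1$. *)

(* Defs.v *)
From HB Require Import structures.
From mathcomp Require Import all_boot all_order all_algebra.
From mathcomp Require Import all_classical all_reals all_analysis.

Set Implicit Arguments.
Unset Strict Implicit.
Unset Printing Implicit Defensive.

Import Order.TTheory GRing.Theory Num.Theory.
Import numFieldNormedType.Exports.

Local Open Scope classical_set_scope.
Local Open Scope ring_scope.

Definition unit_ball (R : realType) (X : normedModType R) : set X :=
  [set x | `|x| <= 1].

Definition unit_sphere (R : realType) (X : normedModType R) : set X :=
  [set x | `|x| = 1].

Arguments unit_ball {R} X.
Arguments unit_sphere {R} X.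

Section bounded_operators.
Context {R : realType} (X Y : normedModType R).

Definition bounded_op_pred : {pred X -> Y} :=
  fun f => `[< linear f /\ exists M : R, forall x, `|f x| <= M * `|x| >].

Record bounded_op := BoundedOp {
  bounded_op_fun :> X -> Y;
  bounded_op_mem : bounded_op_fun \in bounded_op_pred }.

HB.instance Definition _ := [isSub for bounded_op_fun].
HB.instance Definition _ := [Choice of bounded_op by <:].

Lemma bounded_op_submod_closed : submod_closed bounded_op_pred.
Proof.
split.
  apply/asboolP; split; first by move=> a x y; rewrite /= scaler0 addr0.
  by exists 0 => x; rewrite normr0 mul0r.
move=> a f g /asboolP[fl [M fM]] /asboolP[gl [N gN]]; apply/asboolP; split.
  move=> b x y; rewrite !fctE/= fl gl !scalerDr !scalerA [b * a]mulrC.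
  by rewrite !addrA; congr (_ + _); rewrite -!addrA; congr (_ + _); exact: addrC.
exists (`|a| * M + N) => x; rewrite !fctE/= (le_trans (ler_normD _ _))//.
by rewrite normrZ mulrDl lerD// -mulrA ler_wpM2l.
Qed.

HB.instance Definition _ := GRing.isSubmodClosed.Build R (X -> Y)
  bounded_op_pred bounded_op_submod_closed.
HB.instance Definition _ := [SubChoice_isSubLmodule of bounded_op by <:].

Lemma bounded_op_linear (f : bounded_op) : linear f.
Proof. by case: f => f /= /asboolP[]. Qed.

HB.instance Definition _ (f : bounded_op) :=
  GRing.isLinear.Build R X Y *:%R f (bounded_op_linear f).

Definition op_norm (f : bounded_op) : R := sup [set `|f x| | x in unit_ball X].

Lemma op_norm_has_sup (f : bounded_op) : has_sup [set `|f x| | x in unit_ball X].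
Proof.
split; first by exists `|f 0|, 0 => //; rewrite /unit_ball/= normr0.
case: f => f /= fP; have /asboolP[_ [M fM]] := fP.
exists `|M| => _ [x x1 <-]; rewrite (le_trans (fM x))//.
by rewrite (le_trans (ler_norm _))// normrM normr_id ler_piMr.
Qed.

Lemma op_norm_ub (f : bounded_op) x : `|f x| <= op_norm f * `|x|.
Proof.
have [->|x0] := eqVneq x 0; first by rewrite linear0 !normr0 mulr0.
have nx : 0 < `|x| by rewrite normr_gt0.
rewrite -ler_pdivrMr//; apply: ub_le_sup; first by case: (op_norm_has_sup f).
exists (`|x|^-1 *: x).
  by rewrite /unit_ball/= normrZ normfV normr_id mulVf// gt_eqF.
by rewrite linearZ/= normrZ normfV normr_id mulrC.
Qed.

Lemma op_norm_le (f : bounded_op) (M : R) :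
  (forall x, `|x| <= 1 -> `|f x| <= M) -> op_norm f <= M.
Proof.
move=> fM; apply: ge_sup; first by case: (op_norm_has_sup f).
by move=> _ [x x1 <-]; exact: fM.
Qed.

Lemma op_norm_ge (f : bounded_op) x : `|x| <= 1 -> `|f x| <= op_norm f.
Proof.
by move=> x1; apply: ub_le_sup; [case: (op_norm_has_sup f)|exists x].
Qed.

Lemma op_normD (f g : bounded_op) : op_norm (f + g) <= op_norm f + op_norm g.
Proof.
apply: op_norm_le => x x1.
by rewrite (le_trans (ler_normD _ _))// lerD// op_norm_ge.
Qed.

Lemma op_normZ (a : R) (f : bounded_op) : op_norm (a *: f) = `|a| * op_norm f.
Proof.
have le b g : op_norm (b *: g) <= `|b| * op_norm g.
  apply: op_norm_le => x x1; rewrite (_ : (b *: g) x = b *: g x)// normrZ.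
  by rewrite ler_wpM2l// op_norm_ge.
apply/eqP; rewrite eq_le le/=.
have [->|a0] := eqVneq a 0.
  rewrite normr0 mul0r (le_trans (normr_ge0 ((0 *: f) 0)))//.
  by apply: op_norm_ge; rewrite normr0.
have na : 0 < `|a| by rewrite normr_gt0.
rewrite -ler_pdivlMl// -normfV (le_trans _ (le _ _))//.
by rewrite scalerA mulVf// scale1r.
Qed.

Lemma op_norm0_eq0 (f : bounded_op) : op_norm f = 0 -> f = 0.
Proof.
move=> f0; apply/val_inj/funext => x.
have fx0 : f x = 0.
  by apply/eqP; rewrite -normr_le0 (le_trans (op_norm_ub f x))// f0 mul0r.
exact: fx0.
Qed.

HB.instance Definition _ := Lmodule_isNormed.Build R bounded_op
  op_normD op_normZ op_norm0_eq0.

End bounded_operators.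

Notation "''L' ( X , Y )" := (bounded_op X Y)
  (at level 8, format "''L' ( X ,  Y )") : type_scope.

Section c0.
Context (R : realType).

Definition c0_pred : {pred nat -> R^o} :=
  fun u => `[< u @ \oo --> (0 : R^o) >].

Record c0 := C0 {
  c0_seq :> nat -> R^o;
  c0_mem : c0_seq \in c0_pred }.

HB.instance Definition _ := [isSub for c0_seq].
HB.instance Definition _ := [Choice of c0 by <:].

Lemma c0_submod_closed : submod_closed c0_pred.
Proof.
split; first by apply/asboolP; exact: cvg_cst.
move=> a u v /asboolP u0 /asboolP v0; apply/asboolP.
have -> : (0 : R^o) = a *: (0 : R^o) + 0 by rewrite scaler0 addr0.
by apply: cvgD => //; exact: cvgZl_tmp.
Qed.

HB.instance Definition _ := GRing.isSubmodClosed.Build R (nat -> R^o)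
  c0_pred c0_submod_closed.
HB.instance Definition _ := [SubChoice_isSubLmodule of c0 by <:].

Lemma c0_cvg (u : c0) : c0_seq u @ \oo --> (0 : R^o).
Proof. by case: u => u /= /asboolP. Qed.

Definition c0_norm (u : c0) : R := sup [set `|u n| | n in [set: nat]].

Lemma c0_norm_has_sup (u : c0) : has_sup [set `|u n| | n in [set: nat]].
Proof.
split; first by exists `|u 0%N|, 0%N.
have /cvg_seq_bounded/pinfty_ex_gt0[M _ uM] : cvg (c0_seq u @ \oo).
  by apply/cvg_ex; exists 0; exact: c0_cvg.
by exists M => _ [n _ <-]; exact: uM.
Qed.

Lemma c0_norm_ge (u : c0) n : `|u n| <= c0_norm u.
Proof. by apply: ub_le_sup; [case: (c0_norm_has_sup u)|exists n]. Qed.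

Lemma c0_norm_le (u : c0) (M : R) : (forall n, `|u n| <= M) -> c0_norm u <= M.
Proof.
move=> uM; apply: ge_sup; first by case: (c0_norm_has_sup u).
by move=> _ [n _ <-]; exact: uM.
Qed.

Lemma c0_normD (u v : c0) : c0_norm (u + v) <= c0_norm u + c0_norm v.
Proof.
apply: c0_norm_le => n.
by rewrite (le_trans (ler_normD _ _))// lerD// c0_norm_ge.
Qed.

Lemma c0_normZ (a : R) (u : c0) : c0_norm (a *: u) = `|a| * c0_norm u.
Proof.
have le b v : c0_norm (b *: v) <= `|b| * c0_norm v.
  apply: c0_norm_le => n; rewrite (_ : (b *: v) n = b * v n)// normrM.
  by rewrite ler_wpM2l// c0_norm_ge.
apply/eqP; rewrite eq_le le/=.
have [->|a0] := eqVneq a 0.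
  rewrite normr0 mul0r (le_trans (normr_ge0 ((0 *: u) 0%N)))//.
  exact: c0_norm_ge.
have na : 0 < `|a| by rewrite normr_gt0.
rewrite -ler_pdivlMl// -normfV (le_trans _ (le _ _))//.
by rewrite scalerA mulVf// scale1r.
Qed.

Lemma c0_norm0_eq0 (u : c0) : c0_norm u = 0 -> u = 0.
Proof.
move=> u0; apply/val_inj/funext => n.
have un0 : u n = 0 by apply/eqP; rewrite -normr_le0 -u0 c0_norm_ge.
exact: un0.
Qed.

HB.instance Definition _ := Lmodule_isNormed.Build R c0
  c0_normD c0_normZ c0_norm0_eq0.

Lemma c0_complete (F : set_system c0) : ProperFilter F -> cauchy F -> cvg F.
Proof.
move=> FF /cauchyP Fc.
have coord n : cvg ((fun u : c0 => u n) @ F).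
  apply/cauchy_cvgP/cauchyP => e e0.
  have [u Fu] := Fc _ e0; exists (u n).
  apply: (@filterS _ F _ (ball u e)) Fu => v uv.
  exact: le_lt_trans (c0_norm_ge (u - v) n) uv.
pose l n : R^o := lim ((fun u : c0 => u n) @ F).
have near_l e : 0 < e -> exists2 u : c0, F (ball u e) &
    forall n, `|u n - l n| <= e.
  move=> e0; have [u Fu] := Fc _ e0; exists u => // n.
  apply: (cvgr_to_le (F := F)
    (cvg_norm (cvgB (cvg_cst (u n : R^o)) (coord n)))).
  apply: filterS Fu => v uv /=.
  exact: ltW (le_lt_trans (c0_norm_ge (u - v) n) uv).
have lP : l \in c0_pred.
  apply/asboolP/cvgr0Pnorm_le => e e0.
  have e20 : 0 < e / 2 by rewrite divr_gt0.
  have [u _ ul] := near_l _ e20.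
  have /cvgr0Pnorm_le/(_ _ e20) := c0_cvg u; apply: filterS => n un.
  rewrite -[l n](subrK (u n)) (le_trans (ler_normD _ _))// [leRHS]splitr.
  by rewrite lerD// distrC.
apply/cvg_ex; exists (C0 lP); apply/cvgrPdist_le => e e0.
have e20 : 0 < e / 2 by rewrite divr_gt0.
have [u Fu ul] := near_l _ e20; apply: filterS Fu => v uv.
apply: c0_norm_le => n; rewrite (_ : (C0 lP - v) n = l n - v n)//.
rewrite -(subrKA (u n)) (le_trans (ler_normD _ _))// [leRHS]splitr.
rewrite lerD//; first by rewrite distrC.
exact: ltW (le_lt_trans (c0_norm_ge (u - v) n) uv).
Qed.

HB.instance Definition _ := Uniform_isComplete.Build c0 c0_complete.

End c0.

Section Bhatia_Semrl.
Context {R : realType}.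

Definition birkhoff_orth (X : normedModType R) (x y : X) : Prop :=
  forall t : R, `|x| <= `|x + t *: y|.

Definition strong_birkhoff_orth (X : normedModType R) (x y : X) : Prop :=
  forall t : R, t != 0 -> `|x| < `|x + t *: y|.

Definition norm_attaining_set (X Y : normedModType R) (T : 'L(X, Y)) : set X :=
  [set x | unit_sphere X x /\ `|T x| = `|T|].

Definition norm_attaining (X Y : normedModType R) : set 'L(X, Y) :=
  [set T | norm_attaining_set T !=set0].

Definition BSa (X Y : normedModType R) : set 'L(X, Y) :=
  [set T | norm_attaining T /\
    forall S : 'L(X, Y), strong_birkhoff_orth T S ->
      exists2 x0, norm_attaining_set T x0 & birkhoff_orth (T x0) (S x0)].

End Bhatia_Semrl.

Arguments norm_attaining {R} X Y.
Arguments BSa {R} X Y.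

Section property_quasi_beta.
Context {R : realType}.

Definition extreme_point (V : lmodType R) (K : set V) : set V :=
  [set e | K e /\ forall (x y : V) (t : R), K x -> K y -> 0 < t < 1 ->
     e = t *: x + (1 - t) *: y -> x = e /\ y = e].

(* The initial topology for the evaluations at the points of [Y]; the norm
   topology is the one carried by ['L(Y, R^o)] itself. *)
Definition weak_star (Y : normedModType R) : Type :=
  initial_topology (fun f : 'L(Y, R^o) => (f : {ptws Y -> R^o})).

HB.instance Definition _ (Y : normedModType R) :=
  Topological.on (weak_star Y).

(* [sigma] and [rho] are total functions, constrained on [A] only. The supremum
   is extended real, hence [sup < 1] is never met by junk values. *)
Definition quasi_beta (Y : normedModType R) : Prop :=
  exists (A : set 'L(Y, R^o)) (sigma : 'L(Y, R^o) -> Y) (rho : 'L(Y, R^o) -> R),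
  [/\ A `<=` unit_sphere 'L(Y, R^o),
      (forall f, A f -> unit_sphere Y (sigma f)),
      (forall f, A f -> f (sigma f) = 1),
      (forall f g, A f -> A g -> f <> g ->
         `|g (sigma f)| <= rho f /\ rho f < 1) &
      forall e, extreme_point (unit_ball 'L(Y, R^o)) e ->
        exists (Ae : set 'L(Y, R^o)) (t : R),
        [/\ Ae `<=` A, `|t| = 1,
            closure (Ae : set (weak_star Y)) (t *: e) &
            (ereal_sup [set (rho f)%:E | f in Ae] < 1)%E]].

End property_quasi_beta.

(* Main.v *)
Require Import Defs.
From HB Require Import structures.
From mathcomp Require Import all_boot all_order all_algebra.
From mathcomp Require Import all_classical all_reals all_analysis.
From mathcomp Require Import ring lra.

(* Call [S] good of order [n] if some [x0] of the unit ball is almost norming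
   for every functional [z] of the dual ball such that [z \o S] is almost of norm
   [`|S|]. Adding to [S] a small multiple of [y0 (S _) *: S x0] with [y0] norming
   [S x0] shows that such operators are dense; they form an open set, so by Baire
   the operators good of every order are dense. For such an operator the set of
   [z] in the dual ball with [`|z \o S| = `|S|] is nonempty, weak-* closed and
   extremal, hence contains an extreme point of the dual ball.

   Property quasi-beta then gives [w] in [A] with [`|w \o S|] close to [`|S|]
   relative to [1 - rho w]. Since functionals on c0 are l1-sums of a finitely
   supported part and a small tail, a rank-one correction along [sigma w] yields
   [T] with [w \o T] finitely supported and of norm [`|T|], all other [z] in [A]
   having [`|z \o T| <= r < `|T|].

   For any operator [S], if [w \o S] vanishes nowhere on the face of the ball of
   c0 where [w \o T] is maximal, then it has constant sign there, and
   [`|T - l *: S| <= `|T|] for some small [l] of that sign; so [T] is not strongly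
   orthogonal to [S]. A zero of [w \o S] on the face is a point [x] where [T x] is
   orthogonal to [S x]. *)

Set Implicit Arguments.
Unset Strict Implicit.
Unset Printing Implicit Defensive.

Import Order.TTheory GRing.Theory Num.Theory.
Import numFieldNormedType.Exports.

Local Open Scope classical_set_scope.
Local Open Scope ring_scope.

(** * Bounded operators *)

Section operators.
Context {R : realType} (X Y : normedModType R).
Implicit Types S T : 'L(X, Y).

Lemma bounded_opD S T x : (S + T) x = S x + T x. Proof. by []. Qed.

Lemma bounded_opB S T x : (S - T) x = S x - T x. Proof. by []. Qed.

Lemma bounded_opZ (a : R) S x : (a *: S) x = a *: S x. Proof. by []. Qed.

Lemma bounded_opP T x : `|T x| <= `|T| * `|x|. Proof. exact: op_norm_ub. Qed.

Lemma bounded_op1P T x : `|x| <= 1 -> `|T x| <= `|T|.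
Proof. exact: op_norm_ge. Qed.

Lemma bounded_op_normP T (M : R) :
  reflect (forall x, `|x| <= 1 -> `|T x| <= M) (`|T| <= M).
Proof.
apply: (iffP idP) => [TM x x1|]; last exact: op_norm_le.
exact: le_trans (bounded_op1P T x1) TM.
Qed.

Lemma bounded_op_norm_gt T (M : R) :
  M < `|T| -> exists2 x, `|x| <= 1 & M < `|T x|.
Proof.
move=> MT; apply: contrapT => noX; move: MT; apply/negP; rewrite -leNgt.
apply/bounded_op_normP => x x1; rewrite leNgt; apply/negP => Mx.
by apply: noX; exists x.
Qed.

Lemma bounded_op_intro (f : X -> Y) (M : R) : linear f ->
  (forall x, `|f x| <= M * `|x|) -> exists T : 'L(X, Y), forall x, T x = f x.
Proof.
move=> fl fM; have fP : f \in @bounded_op_pred R X Y.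
  by apply/asboolP; split => //; exists M.
by exists (BoundedOp fP).
Qed.

Lemma bounded_op_eq S T : (forall x, S x = T x) -> S = T.
Proof. by move=> ST; apply/val_inj/funext. Qed.

End operators.

Lemma bounded_op_comp {R : realType} (X Y Z : normedModType R)
    (S : 'L(Y, Z)) (T : 'L(X, Y)) : exists U : 'L(X, Z), forall x, U x = S (T x).
Proof.
apply: (@bounded_op_intro _ _ _ _ (`|S| * `|T|)) => [a x y|x].
  by rewrite /= !linearP.
rewrite (le_trans (bounded_opP _ _))// -mulrA ler_wpM2l//; exact: bounded_opP.
Qed.

(** * Completeness of the space of operators *)

Section bounded_op_completeness.
Context {R : realType} (X : normedModType R) (Y : completeNormedModType R).

(** A Cauchy filter converges pointwise because [Y] is complete, and the Cauchy estimate survives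
    the pointwise limit with a bound proportional to [|x|]. Completeness is what opens the space of
    operators to the Baire argument. *)
Lemma bounded_op_complete (F : set_system 'L(X, Y)) :
  ProperFilter F -> cauchy F -> cvg F.
Proof.
move=> FF /cauchyP Fc.
have coord x : cvg ((fun T : 'L(X, Y) => T x) @ F).
  apply/cauchy_cvgP/cauchyP => e e0.
  have e1 : 0 < e / (`|x| + 1) by rewrite divr_gt0// ltr_wpDl.
  have [T FT] := Fc _ e1; exists (T x).
  apply: (@filterS _ F _ (ball T (e / (`|x| + 1)))) FT => S.
  move=> TS; rewrite -ball_normE /=.
  rewrite -bounded_opB (le_lt_trans (bounded_opP _ _))//.
  rewrite (@le_lt_trans _ _ (`|T - S| * (`|x| + 1)))//.
    by rewrite ler_wpM2l// lerDl.
  by rewrite -ltr_pdivlMr// ltr_wpDl.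
pose l x : Y := lim ((fun T : 'L(X, Y) => T x) @ F).
have near_l e : 0 < e -> exists2 T : 'L(X, Y), F (ball T e) &
    forall x, `|T x - l x| <= e * `|x|.
  move=> e0; have [T FT] := Fc _ e0; exists T => // x.
  apply: (cvgr_to_le (F := F)
    (cvg_norm (cvgB (cvg_cst (T x : Y)) (coord x)))).
  apply: filterS FT => S TS.
  change (`|(T - S) x| <= e * `|x|).
  by rewrite (le_trans (bounded_opP _ _))// ler_wpM2r// ltW.
have ll : linear l.
  move=> a x y; apply: cvg_lim => //.
  rewrite (_ : (fun T : 'L(X, Y) => T (a *: x + y)) =
    (fun T : 'L(X, Y) => a *: T x + T y)).
    by apply: cvgD; [apply: cvgZl_tmp|]; exact: coord.
  by apply/funext => T; rewrite linearP.
have [T0 _ T0l] := near_l 1 ltr01.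
have [L LE] : exists L : 'L(X, Y), forall x, L x = l x.
  apply: (@bounded_op_intro _ _ _ _ (1 + `|T0|)) => // x.
  rewrite -[l x](subrK (T0 x)) (le_trans (ler_normD _ _))// mulrDl lerD//.
    by rewrite distrC.
  exact: bounded_opP.
apply/cvg_ex; exists L; apply/cvgrPdist_le => e e0.
have e20 : 0 < e / 2 by rewrite divr_gt0.
have [T FT Tl] := near_l _ e20; apply: filterS FT => S TS.
apply/bounded_op_normP => x x1.
rewrite bounded_opB LE -(subrKA (T x)) (le_trans (ler_normD _ _))// [leRHS]splitr.
rewrite lerD//.
  by rewrite distrC (le_trans (Tl x))// ler_piMr// ltW.
rewrite -bounded_opB (le_trans (bounded_op1P _ x1))//; exact: ltW.
Qed.

End bounded_op_completeness.

HB.instance Definition _ (R : realType) (X : normedModType R)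
  (Y : completeNormedModType R) :=
  Uniform_isComplete.Build (bounded_op X Y) (@bounded_op_complete R X Y).

(** * The Hahn-Banach theorem *)

Section hahn_banach.
Context {R : realType} (V : lmodType R).

Definition sublinear (p : V -> R) :=
  (forall x y, p (x + y) <= p x + p y) /\
  (forall (a : R) x, 0 < a -> p (a *: x) = a * p x).

Implicit Types p q : V -> R.

Lemma sublinear0 p : sublinear p -> p 0 = 0.
Proof.
by move=> [_ /(_ 2 0 (ltr0n _ 2))]; rewrite scaler0 => p0; lra.
Qed.

Lemma sublinearN p x : sublinear p -> - p (- x) <= p x.
Proof. by move=> sp; have := sp.1 x (- x); rewrite subrr sublinear0//; lra. Qed.

Definition shift_set p y x : set R :=
  [set p (x + t *: y) - t * p y | t in [set t | 0 <= t]].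

(** This map is again sublinear and below [p], but its value at [- y] drops to at most [- p y].
    Hence any linear map below it takes the value [p y] at [y]. *)
Definition sublinear_shift p y x : R := inf (shift_set p y x).

(** Subadditivity gives [p (t *: y) <= p (x + t *: y) + p (- x)], so [- p (- x)] is a lower
    bound. *)
Lemma shift_set_has_inf p y x : sublinear p -> has_inf (shift_set p y x).
Proof.
move=> sp; split; first by exists (p (x + 0 *: y) - 0 * p y), 0 => /=.
exists (- p (- x)) => _ [t /= t0 <-].
have -> : t * p y = p (t *: y).
  case: ltgtP t0 => // [t0|<-] _; first by rewrite sp.2.
  by rewrite mul0r scale0r sublinear0.
have := sp.1 (x + t *: y) (- x); rewrite addrAC subrr add0r; lra.
Qed.

Lemma sublinear_shift_le p y x t : sublinear p -> 0 <= t ->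
  sublinear_shift p y x <= p (x + t *: y) - t * p y.
Proof.
move=> sp t0; apply: ge_inf; first exact: (shift_set_has_inf y x sp).2.
by exists t.
Qed.

Lemma le_sublinear_shift p y x (c : R) : sublinear p ->
  (forall t, 0 <= t -> c <= p (x + t *: y) - t * p y) ->
  c <= sublinear_shift p y x.
Proof.
move=> sp cp; apply: lb_le_inf; first exact: (shift_set_has_inf y x sp).1.
by move=> _ [t /= t0 <-]; exact: cp.
Qed.

Lemma sublinear_shift_le_id p y x : sublinear p -> sublinear_shift p y x <= p x.
Proof.
move=> sp; apply: le_trans (sublinear_shift_le y x sp (lexx 0)) _.
by rewrite scale0r addr0 mul0r subr0.
Qed.

Lemma sublinear_shift_oppr p y : sublinear p -> sublinear_shift p y (- y) <= - p y.
Proof.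
move=> sp; apply: le_trans (sublinear_shift_le y (- y) sp ler01) _.
by rewrite scale1r addNr sublinear0// mul1r sub0r.
Qed.

Lemma sublinear_shiftP p y : sublinear p -> sublinear (sublinear_shift p y).
Proof.
move=> sp; split=> [x x'|a x a0].
  rewrite -lerBlDr; apply: le_sublinear_shift => // t t0.
  rewrite lerBlDr -lerBlDl; apply: le_sublinear_shift => // t' t'0.
  have := sublinear_shift_le y (x + x') sp (addr_ge0 t0 t'0).
  have := sp.1 (x + t *: y) (x' + t' *: y).
  by rewrite addrACA -scalerDl; lra.
have le b z : 0 < b ->
    sublinear_shift p y (b *: z) <= b * sublinear_shift p y z.
  move=> b0; rewrite -ler_pdivrMl//; apply: le_sublinear_shift => // t t0.
  rewrite ler_pdivrMl// mulrBr -sp.2// scalerDr scalerA mulrA.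
  by apply: sublinear_shift_le => //; rewrite mulr_ge0// ltW.
apply/eqP; rewrite eq_le le//= -ler_pdivlMl//.
have := le a^-1 (a *: x); rewrite invr_gt0 => /(_ a0).
by rewrite scalerA mulVf ?gt_eqF// scale1r.
Qed.

(** By minimality [p] lies below its own shift along [y], which forces [p (- y) = - p y]. An odd
    sublinear map is linear. *)
Lemma minimal_sublinear_linear p : sublinear p ->
  (forall q, sublinear q -> (forall x, q x <= p x) -> forall x, p x <= q x) ->
  linear (p : V -> R^o).
Proof.
move=> sp pmin.
have pN y : p (- y) = - p y.
  apply/eqP; rewrite eq_le; apply/andP; split; last first.
    by have := sublinearN (- y) sp; rewrite opprK.
  apply: le_trans (sublinear_shift_oppr y sp).
  apply: pmin; first exact: sublinear_shiftP.
  by move=> x; exact: sublinear_shift_le_id.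
have pD x y : p (x + y) = p x + p y.
  apply/eqP; rewrite eq_le sp.1/=.
  by have := sp.1 (- x) (- y); rewrite -opprD !pN; lra.
move=> a x y; rewrite pD; congr (_ + _).
have [a0|a0|->] := ltgtP a 0; last by rewrite !scale0r sublinear0.
  by rewrite -[a]opprK scaleNr pN sp.2 ?oppr_gt0// scaleNr.
exact: sp.2.
Qed.

(** Zorn's lemma for the sublinear maps below [p]. The order is reversed, so that a maximal element
    is a pointwise minimal map; chains are bounded by their pointwise infimum. *)
Lemma exists_linear_le_sublinear p : sublinear p ->
  exists q : V -> R^o, linear q /\ forall x, q x <= p x.
Proof.
move=> sp.
pose T := {q : V -> R | sublinear q /\ forall x, q x <= p x}.
pose rel (q r : T) : bool := `[< forall x, sval r x <= sval q x >].
have [| | |[q [sq qp]] qmin] := @ZL_preorder T (exist _ p (conj sp (fun=> lexx _))) rel.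
- by move=> q; apply/asboolP.
- move=> q r s /asboolP qr /asboolP rs; apply/asboolP => x.
  exact: le_trans (qr x).
- move=> A Atot; have [[q0 Aq0]|A0] := pselect (A !=set0); last first.
    by exists (exist _ p (conj sp (fun=> lexx _))) => q Aq; case: A0; exists q.
  pose im x : set R := [set sval q x | q in A].
  have im_inf x : has_inf (im x).
    split; first by exists (sval q0 x), q0.
    exists (- p (- x)) => _ [q Aq <-].
    have [sq qp] := svalP q.
    by rewrite (le_trans _ (sublinearN x sq))// lerN2.
  pose m x : R := inf (im x).
  have m_le (q : T) x : A q -> m x <= sval q x.
    by move=> Aq; apply: ge_inf; [exact: (im_inf x).2|exists q].
  have le_m c x : (forall q : T, A q -> c <= sval q x) -> c <= m x.
    move=> cq; apply: lb_le_inf; first exact: (im_inf x).1.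
    by move=> _ [q Aq <-]; exact: cq.
  have sm : sublinear m.
    split=> [x y|a x a0].
      rewrite -lerBlDr; apply: (le_m) => q Aq.
      rewrite lerBlDr -lerBlDl; apply: (le_m) => q' Aq'; rewrite lerBlDl.
      (* Two members of the chain are comparable; the subadditivity of the smaller one bounds the
         infimum at [x + y]. *)
      have [/asboolP|/asboolP] := Atot _ _ Aq Aq' => qq'.
        apply: le_trans (m_le q' _ Aq') _.
        have [[subq _] _] := svalP q'.
        by apply: le_trans (subq _ _) _; rewrite lerD2r.
      apply: le_trans (m_le q _ Aq) _.
      have [[subq _] _] := svalP q.
      by apply: le_trans (subq _ _) _; rewrite lerD2l.
    have le b z : 0 < b -> m (b *: z) <= b * m z.
      move=> b0; rewrite -ler_pdivrMl//; apply: (le_m) => q Aq.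
      rewrite ler_pdivrMl//; have [[_ <-//] _] := svalP q; exact: m_le.
    apply/eqP; rewrite eq_le le//= -ler_pdivlMl//.
    have := le a^-1 (a *: x); rewrite invr_gt0 => /(_ a0).
    by rewrite scalerA mulVf ?gt_eqF// scale1r.
  have mp x : m x <= p x.
    by apply: le_trans (m_le q0 x Aq0) _; have [_] := svalP q0.
  exists (exist _ m (conj sm mp)) => q Aq; apply/asboolP => x /=; exact: m_le.
exists q; split=> //; apply: minimal_sublinear_linear => // r sr rq x.
have rp y : r y <= p y by apply: le_trans (qp y).
have /asboolP /= := qmin (exist _ r (conj sr rp)) (introT (asboolP _) rq).
exact.
Qed.

End hahn_banach.

(** * The weak-* topology *)

(** A linear map below the shift of the norm along [y] is bounded by the norm and is at most [- |y|]
    at [- y]. *)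
Lemma exists_norming_functional {R : realType} (Y : normedModType R) (y : Y) :
  exists f : 'L(Y, R^o), `|f| <= 1 /\ f y = `|y|.
Proof.
have sn : sublinear (fun x : Y => `|x|).
  by split=> [|a x a0]; [exact: ler_normD|rewrite normrZ gtr0_norm].
have [q [ql qle]] := exists_linear_le_sublinear (sublinear_shiftP y sn).
have qn x : q x <= `|x|.
  exact: le_trans (qle x) (sublinear_shift_le_id y x sn).
have qN x : q (- x) = - q x.
  have := ql (-1) x 0; rewrite scaleN1r addr0 scaleN1r => ->.
  by have := ql (-1) 0 0; rewrite scaler0 addr0 scaleN1r; lra.
have q_norm x : `|q x| <= `|x|.
  by rewrite ler_norml -lerN2 opprK -qN qn -normrN qn.
have [f fE] : exists f : 'L(Y, R^o), forall x, f x = q x.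
  by apply: (@bounded_op_intro _ _ _ _ 1) => // x; rewrite mul1r.
exists f; split.
  by apply/bounded_op_normP => x x1; rewrite fE (le_trans (q_norm x)).
apply/eqP; rewrite fE eq_le qn/= -lerN2 -qN.
exact: le_trans (qle _) (sublinear_shift_oppr y sn).
Qed.

Section weak_star_topology.
Context {R : realType} (Y : normedModType R).

Lemma weak_star_eval_continuous (y : Y) :
  continuous (fun f : weak_star Y => (f : 'L(Y, R^o)) y).
Proof.
move=> f; apply: (@continuous_comp (weak_star Y) {ptws Y -> R^o} R^o
  (fun f => (f : 'L(Y, R^o)) : {ptws Y -> R^o}) (fun g => g y)).
  exact: initial_continuous.
exact: (@proj_continuous Y (fun=> R^o) y).
Qed.

Lemma weak_star_cvg (F : set_system (weak_star Y)) (f : weak_star Y) :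
  Filter F ->
  (forall y, (fun g : weak_star Y => (g : 'L(Y, R^o)) y) @ F -->
             ((f : 'L(Y, R^o)) y : R^o)) ->
  F --> f.
Proof.
move=> FF cF.
pose i (g : weak_star Y) : {ptws Y -> R^o} := (g : 'L(Y, R^o)).
have iF : i @ F --> i f by apply/pointwise_cvgP => y; exact: cF.
move=> A /= [_ [[B oB <-] Bf BA]].
have /iF FB : nbhs (i f) B by apply: open_nbhs_nbhs.
exact: filterS BA FB.
Qed.

(** Banach-Alaoglu through ultrafilters: each evaluation stays in a compact segment and so
    converges, and the limits form a linear map of norm at most 1. *)
Lemma weak_star_ball_compact :
  compact (unit_ball 'L(Y, R^o) : set (weak_star Y)).
Proof.
rewrite compact_ultra => F FU FB.
pose ev y (g : weak_star Y) : R^o := (g : 'L(Y, R^o)) y.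
have lim_ev y : exists c : R^o, ev y @ F --> c.
  have Fy : F (ev y @^-1` `[- `|y|, `|y|]).
    apply: filterS FB => g g1; rewrite /= in_itv /= -ler_norml.
    by apply: le_trans (bounded_opP (g : 'L(Y, R^o)) y) _; rewrite ler_piMl.
  have [c [_ Fc]] := @segment_compact R (- `|y|) `|y| (ev y @ F) _ Fy.
  (* A cluster point of an ultrafilter is its limit: otherwise the complement of [U] would have to
     meet [U]. *)
  exists c => U Uc; have [//|FnU] := in_ultra_setVsetC (ev y @^-1` U) FU.
  have [z []] := Fc (~` U) U FnU Uc; exact.
have [l lE] := choice lim_ev.
have ll : linear l.
  move=> a x y.
  have : ev (a *: x + y) @ F --> a *: l x + l y.
    rewrite (_ : ev _ = (fun g => a *: ev x g + ev y g)).
      by apply: cvgD; [apply: cvgZl_tmp|]; exact: lE.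
    by apply/funext => g; rewrite /ev linearP.
  move=> /cvg_lim <- //; apply/esym/cvg_lim => //; exact: lE.
have ln x : `|l x| <= `|x|.
  apply: (cvgr_to_le (F := F) (cvg_norm (lE x))).
  apply: filterS FB => g g1.
  by apply: le_trans (bounded_opP (g : 'L(Y, R^o)) x) _; rewrite ler_piMl.
have [f fE] : exists f : 'L(Y, R^o), forall x, f x = l x.
  by apply: (@bounded_op_intro _ _ _ _ 1) => // x; rewrite mul1r.
exists f; split.
  by apply/bounded_op_normP => x x1; rewrite fE (le_trans (ln x)).
by apply: weak_star_cvg => y; rewrite fE; exact: lE.
Qed.

Lemma weak_star_closed_norm_ge (y : Y) (c : R) :
  closed ([set f | c <= `|f y|] : set (weak_star Y)).
Proof.
apply: (@closed_comp (weak_star Y) R (fun f => `|(f : 'L(Y, R^o)) y|)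
  [set r | c <= r]); last exact: closed_ge.
move=> f _; apply: (@continuous_comp (weak_star Y) R^o R
  (fun f => (f : 'L(Y, R^o)) y) Num.norm).
  exact: weak_star_eval_continuous.
exact: norm_continuous.
Qed.

Lemma weak_star_closed_norm_le (y : Y) (c : R) :
  closed ([set f | `|f y| <= c] : set (weak_star Y)).
Proof.
apply: (@closed_comp (weak_star Y) R (fun f => `|(f : 'L(Y, R^o)) y|)
  [set r | r <= c]); last exact: closed_le.
move=> f _; apply: (@continuous_comp (weak_star Y) R^o R
  (fun f => (f : 'L(Y, R^o)) y) Num.norm).
  exact: weak_star_eval_continuous.
exact: norm_continuous.
Qed.

Lemma weak_star_closure_norm_le (B : set 'L(Y, R^o)) (f : 'L(Y, R^o)) y (c : R) :
  (forall g, B g -> `|g y| <= c) -> closure (B : set (weak_star Y)) f ->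
  `|f y| <= c.
Proof.
move=> Bc /(@closureS (weak_star Y) _ [set g : 'L(Y, R^o) | `|g y| <= c] Bc).
exact: weak_star_closed_norm_le.
Qed.

Lemma weak_star_ball_closed :
  closed (unit_ball 'L(Y, R^o) : set (weak_star Y)).
Proof.
rewrite (_ : unit_ball _ = \bigcap_(x in [set x : Y | `|x| <= 1])
    [set f : 'L(Y, R^o) | `|f x| <= 1]).
  by apply: closed_bigI => x _; exact: weak_star_closed_norm_le.
apply/seteqP; split=> [f f1 x x1|f f1]; last exact/bounded_op_normP.
exact: (bounded_op_normP f 1 f1 x x1).
Qed.

Lemma weak_star_closed_eval_eq (y : Y) (c : R) :
  closed ([set f | f y = c] : set (weak_star Y)).
Proof.
apply: (@closed_comp (weak_star Y) R^o (fun f => (f : 'L(Y, R^o)) y) [set c]).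
  by move=> f _; exact: weak_star_eval_continuous.
exact: closed_eq.
Qed.

End weak_star_topology.

(** * Extreme points of the dual ball *)

Definition extremal_subset {R : realType} {V : lmodType R} (K F : set V) :=
  F `<=` K /\ forall (x y : V) (t : R), K x -> K y -> 0 < t < 1 ->
    F (t *: x + (1 - t) *: y) -> F x /\ F y.

Section extreme_points.
Context {R : realType} (Y : normedModType R).
Local Notation ball := (unit_ball 'L(Y, R^o)).

Definition weak_star_face (G : set 'L(Y, R^o)) :=
  [/\ G !=set0, closed (G : set (weak_star Y)) & extremal_subset ball G].

(** Evaluation at [y] is weak-* continuous, so it has a maximum on the compact set [G]. A proper
    convex combination reaches this maximum only if both of its ends do. *)
Lemma weak_star_face_max (G : set 'L(Y, R^o)) (y : Y) : weak_star_face G ->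
  exists M : R, weak_star_face [set f | G f /\ f y = M].
Proof.
move=> [G0 Gcl [GB Gext]].
have Gco : compact (G : set (weak_star Y)).
  exact: subclosed_compact Gcl (weak_star_ball_compact (Y := Y)) GB.
have [|f fG fmax] := compact_EVT_max G0 Gco
    (f := fun f : weak_star Y => (f : 'L(Y, R^o)) y : R).
  by apply: continuous_subspaceT; exact: weak_star_eval_continuous.
have {}fmax g : G g -> g y <= (f : 'L(Y, R^o)) y.
  by move=> Gg; apply: fmax; rewrite inE.
exists ((f : 'L(Y, R^o)) y); split.
- by exists f; split => //; move: fG; rewrite inE.
- by apply: closedI => //; exact: weak_star_closed_eval_eq.
split=> [g [Gg _]|g h t Bg Bh t01 [Ggh ghy]]; first exact: GB.
have [Gg Gh] := Gext _ _ _ Bg Bh t01 Ggh.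
have gf := fmax _ Gg; have hf := fmax _ Gh.
move: t01 ghy => /andP[t0 t1].
rewrite bounded_opD !bounded_opZ /= -![_ *: _]/(_ * _).
by split; split => //; apply/eqP; rewrite eq_le ?gf ?hf/=; nra.
Qed.

(** The Krein-Milman argument: Zorn's lemma gives a minimal face inside [G], and a minimal face is a
    single point, which is then extreme. *)
Lemma weak_star_face_extreme_point (G : set 'L(Y, R^o)) : weak_star_face G ->
  exists2 e, G e & extreme_point ball e.
Proof.
move=> Gface.
pose T := {H : set 'L(Y, R^o) | weak_star_face H /\ H `<=` G}.
pose rel (H K : T) : bool := `[< sval K `<=` sval H >].
have G_T : weak_star_face G /\ G `<=` G by split; [|exact: subset_refl].
have [| | |[H [Hface HG]] Hmin] := @ZL_preorder T (exist _ G G_T) rel.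
- by move=> H; apply/asboolP.
- move=> H K L /asboolP HK /asboolP KL; apply/asboolP.
  exact: subset_trans KL HK.
- move=> A Atot; have [[H0 AH0]|A0] := pselect (A !=set0); last first.
    by exists (exist _ G G_T) => H AH; case: A0; exists H.
  pose I := \bigcap_(H in A) sval H.
  have I_sub H : A H -> I `<=` sval H by move=> AH f; exact.
  have Tface (H : T) : weak_star_face (sval H) by case: (svalP H).
  (* The chain generates a proper filter; by compactness it has a cluster point, which lies in every
     closed face of the chain. *)
  have FF : ProperFilter (filter_from A (fun H : T => (sval H : set (weak_star Y)))).
    apply: filter_from_proper; last by move=> H _; case: (Tface H).
    apply: filter_from_filter; first by exists H0.
    move=> H K AH AK; have [/asboolP HK|/asboolP KH] := Atot _ _ AH AK.
      by exists K => // f Kf; split => //; exact: HK.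
    by exists H => // f Hf; split => //; exact: KH.
  have Iface : weak_star_face I.
    split.
    + have [|f [_ clf]] := @weak_star_ball_compact R Y _ FF.
        by exists H0 => //; case: (Tface H0) => _ _ [].
      exists f => H AH; have [_ Hcl _] := Tface H.
      by apply: Hcl => U fU; apply: clf fU; exists H.
    + apply: closed_bigI => H _; by case: (Tface H).
    + split=> [f If|f g t Bf Bg t01 Ifg].
        by have [_ _ [HB _]] := Tface H0; apply: HB; exact: I_sub If.
      by split=> H AH; have [_ _ [_ /(_ f g t Bf Bg t01)]] := Tface H;
        case => //; exact: I_sub Ifg.
  have IG : I `<=` G.
    by move=> f If; have [_] := svalP H0; apply; exact: I_sub If.
  by exists (exist _ I (conj Iface IG)) => H AH; apply/asboolP => /=; exact: I_sub.
(* For each [y], the part of [H] where evaluation at [y] is maximal is a face, hence all of [H] by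
   minimality; so every evaluation is constant on [H]. *)
have H1 f g : H f -> H g -> f = g.
  move=> Hf Hg; apply: bounded_op_eq => y.
  have [M Mface] := weak_star_face_max y Hface.
  have HMG : [set f | H f /\ f y = M] `<=` G by move=> h [Hh _]; exact: (HG h).
  have /asboolP/= HM : rel (exist _ _ (conj Mface HMG)) (exist _ H (conj Hface HG)).
    by apply: Hmin; apply/asboolP => h [].
  by rewrite (HM f Hf).2 (HM g Hg).2.
have [[e He] _ [HB Hext]] := Hface.
exists e; first exact: (HG e); split; first exact: HB.
move=> f g t Bf Bg t01 efg.
have [|Hf Hg] := Hext f g t Bf Bg t01; first by rewrite -efg.
by split; exact: H1.
Qed.

Lemma exists_norming_extreme_point (y : Y) :
  exists2 e, extreme_point ball e & e y = `|y|.
Proof.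
have [f [f1 fy]] := exists_norming_functional y.
have face : weak_star_face [set g | ball g /\ g y = `|y|].
  split.
  - by exists f.
  - apply: closedI; last exact: weak_star_closed_eval_eq.
    exact: weak_star_ball_closed.
  split=> [g []//|g h t Bg Bh /andP[t0 t1] [_]].
  have gy : g y <= `|y|.
    by apply: le_trans (ler_norm _) (le_trans (bounded_opP g y) _); rewrite ler_piMl.
  have hy : h y <= `|y|.
    by apply: le_trans (ler_norm _) (le_trans (bounded_opP h y) _); rewrite ler_piMl.
  rewrite bounded_opD !bounded_opZ /= -![_ *: _]/(_ * _) => ghy.
  by split; split => //; apply/eqP; rewrite eq_le ?gy ?hy/=; nra.
have [e [Be ey] ext] := weak_star_face_extreme_point face.
by exists e.
Qed.

End extreme_points.

(** * Operators whose adjoint attains its norm at an extreme point *)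

(** Used with [M = |S|], [a = |S x0|], [N = |S'|] for the perturbed operator [S'], [q = |z (S x)|],
    [p = |y0 (S x)|] and [w = |z (S x0)|]. The two bounds around [N] give [u * w > u * M - O(th)]
    for [u = h * M]. Dividing by [u] makes [w] close to [M], and then [(1 + h * a) * w] close to
    [N]. *)
Lemma zizler_estimate (R : realFieldType) (M a h th p w q c N : R) :
  0 < h -> 0 < M -> 0 < th -> M - th < a -> a <= M -> 0 <= p <= M -> 0 <= w <= M ->
  q <= M -> a * (1 + h * a) <= N -> N <= M + h * M * M ->
  N - th < q + h * p * w ->
  th * (2 * (1 + h * M) ^+ 2 / (h * M) + h * M + 1) <= c ->
  N + th < (1 + h * a) * w + c.
Proof.
move=> h0 M0 th0 aM_ aM /andP[p0 pM] /andP[w0 wM] qM Nge Nle Nlt; set u := h * M.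
have u0 : 0 < u by rewrite mulr_gt0.
have uE : u = h * M by [].
rewrite -uE in Nle.
clearbody u.
set k := 2 * (1 + u) ^+ 2 / u => thc.
have kE : k * u = 2 * (1 + u) ^+ 2 by rewrite /k divfK// gt_eqF.
clearbody k.
have hpw : h * p * w <= u * w by rewrite uE ler_wpM2r// ler_wpM2l// ltW.
have haa : u * M - 2 * u * th <= h * (a * a).
  rewrite uE -subr_ge0.
  have -> : h * (a * a) - (h * M * M - 2 * (h * M) * th) =
    h * ((M - a) ^+ 2 + 2 * M * (th - (M - a))) by ring.
  by rewrite mulr_ge0 ?addr_ge0 ?sqr_ge0 ?mulr_ge0// ?ltW//; lra.
have uw : u * M - th * (2 * (1 + u)) < u * w.
  have : a * (1 + h * a) = a + h * (a * a) by ring.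
  lra.
have w_lt : (1 + u) * M - th * k < (1 + u) * w.
  rewrite -(ltr_pM2l u0) mulrBr mulrCA [u * (th * k)]mulrCA [u * k]mulrC kE.
  rewrite [ltRHS]mulrCA.
  have -> : (1 + u) * (u * M) - th * (2 * (1 + u) ^+ 2) =
    (1 + u) * (u * M - th * (2 * (1 + u))) by ring.
  by rewrite ltr_pM2l// addr_gt0.
have hw : (1 + u) * w - u * th <= (1 + h * a) * w.
  have -> : (1 + h * a) * w = (1 + u) * w - h * ((M - a) * w) by rewrite uE; ring.
  rewrite lerD2l lerN2 uE -mulrA ler_wpM2l// ?(ltW h0)//.
  by rewrite [leRHS]mulrC ler_pM//; lra.
have : th * (k + u + 1) = th * k + u * th + th by ring.
lra.
Qed.

Section zizler.
Context {R : realType} (X Y : normedModType R).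

(** The margin [d] occurs both in the assumption and in the conclusion; the slack in each is what
    makes the condition stable under small changes of [S]. *)
Definition zizler_witness (n : nat) (S : 'L(X, Y)) (x0 : X) :=
  exists d : R, [/\ `|x0| <= 1, 0 < d &
    forall (z : 'L(Y, R^o)) (x : X), `|z| <= 1 -> `|x| <= 1 ->
      `|S| - d < `|z (S x)| -> `|S| + d < `|z (S x0)| + n.+1%:R^-1].

Definition zizler_set (n : nat) : set 'L(X, Y) :=
  [set S | exists x0, zizler_witness n S x0].

Lemma functional_op_le (S : 'L(X, Y)) (z : 'L(Y, R^o)) x : `|z| <= 1 -> `|x| <= 1 ->
  `|z (S x)| <= `|S|.
Proof.
move=> z1 x1; apply: le_trans (bounded_opP z _) _.
have := bounded_op1P S x1; have := normr_ge0 (S x); nra.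
Qed.

Lemma functional_op_lip (S S' : 'L(X, Y)) (z : 'L(Y, R^o)) x : `|z| <= 1 -> `|x| <= 1 ->
  `|z (S x)| <= `|z (S' x)| + `|S - S'|.
Proof.
move=> z1 x1; have := functional_op_le (S - S') z1 x1.
rewrite bounded_opB linearB /= => le.
rewrite -[z (S x)](subrK (z (S' x))) addrC.
by apply: le_trans (ler_normD _ _) _; rewrite lerD2l.
Qed.

(** A perturbation smaller than [d / 4] keeps the witness [x0] and costs half of the margin. *)
Lemma open_zizler_set n : open (zizler_set n).
Proof.
rewrite openE => S [x0 [d [x01 d0 Sd]]].
have d40 : 0 < d / 4 by rewrite divr_gt0.
apply/nbhs_ballP; exists (d / 4) => //= S' SS'.
have {}SS' : `|S - S'| < d / 4 by exact: SS'.
have S'S : `|S' - S| < d / 4 by rewrite distrC.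
have d20 : 0 < d / 2 by rewrite divr_gt0.
exists x0, (d / 2); split => // z x z1 x1 zS'x.
have := ler_normD (S' - S) S; rewrite subrK => nS'.
have := ler_normD (S - S') S'; rewrite subrK => nS.
have l1 := functional_op_lip S' S z1 x1.
have l2 := functional_op_lip S S' z1 x01.
have /(Sd z x z1 x1) : `|S| - d < `|z (S x)| by lra.
move: (n.+1%:R^-1) => c; lra.
Qed.

Lemma dense_zizler_set n : dense (zizler_set n).
Proof.
move=> O [S OS] oO.
have /nbhs_ballP[eps /= eps0 ballO] : nbhs S O by apply: open_nbhs_nbhs.
set c : R := n.+1%:R^-1; have c0 : 0 < c by rewrite invr_gt0.
have [M0|Mneq0] := eqVneq `|S| 0.
  exists S; split => //; exists 0, (c / 2); split; rewrite ?normr0//.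
    by rewrite divr_gt0.
  move=> z x _ _ _; rewrite M0 !linear0 normr0 add0r add0r -/c; lra.
set M := `|S| in Mneq0; have M0 : 0 < M by rewrite lt_neqAle eq_sym Mneq0 normr_ge0.
(* The perturbation will have norm at most [h * M ^+ 2], that is [eps / 2]. *)
pose h := eps / (2 * M ^+ 2); have h0 : 0 < h.
  by rewrite divr_gt0// mulr_gt0// exprn_gt0.
have hE : h * M ^+ 2 = eps / 2 by rewrite /h; field; rewrite gt_eqF.
clearbody h; pose u := h * M; have u0 : 0 < u by rewrite mulr_gt0.
pose K := 2 * (1 + u) ^+ 2 / u + u + 1.
have K0 : 0 < K by rewrite !addr_gt0// divr_gt0// mulr_gt0// exprn_gt0// addr_gt0.
(* [K] is the factor of [th] in the last hypothesis of [zizler_estimate]. The same [th] measures how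
   nearly [x0] norms [S] and serves as margin for [S']. *)
pose th := c / K; have th0 : 0 < th by rewrite divr_gt0.
have thK : th * K <= c by rewrite /th divfK// gt_eqF.
clearbody th.
have [x0 x01 x0M] : exists2 x0, `|x0| <= 1 & M - th < `|S x0|.
  by apply: bounded_op_norm_gt; rewrite ltrBlDr ltrDl.
have [y0 [y01 y0S]] := exists_norming_functional (S x0).
set a := `|S x0| in x0M y0S.
have aM : a <= M by exact: bounded_op1P.
have a0 : 0 <= a by exact: normr_ge0.
have [S' S'E] : exists S' : 'L(X, Y), forall x, S' x = S x + (h * y0 (S x)) *: S x0.
  apply: (@bounded_op_intro _ _ _ _ (M + h * M * M)) => [b x y|x].
    rewrite !linearP /= -[_ *: (_ : R^o)]/(_ * _) mulrDr scalerDl scalerDr !scalerA.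
    by rewrite mulrCA !addrA; congr (_ + _); rewrite addrAC.
  apply: le_trans (ler_normD _ _) _.
  rewrite mulrDl lerD//; first exact: bounded_opP.
  rewrite normrZ normrM gtr0_norm// -!mulrA ler_wpM2l ?(ltW h0)//.
  have y0Sx : `|y0 (S x)| <= M * `|x|.
    apply: le_trans (bounded_opP _ _) _; apply: le_trans (bounded_opP S x).
    by rewrite ler_piMl.
  by rewrite [leRHS]mulrC -/a ler_pM.
have y0S_le x : `|x| <= 1 -> `|y0 (S x)| <= M.
  by move=> x1; exact: functional_op_le.
have S'S : `|S' - S| <= u * M.
  apply/bounded_op_normP => x x1; rewrite bounded_opB S'E addrC addKr normrZ normrM.
  rewrite gtr0_norm// /u -!mulrA ler_wpM2l ?(ltW h0)// -/a.
  by rewrite ler_pM// y0S_le.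
exists S'; split.
  apply: ballO; change (`|S - S'| < eps); rewrite distrC.
  by apply: le_lt_trans S'S _; rewrite /u -mulrA -expr2 hE; lra.
have nS'_le : `|S'| <= M + u * M.
  have := ler_normD (S' - S) S; rewrite subrK -/M; lra.
have nS'_ge : a * (1 + h * a) <= `|S'|.
  have := functional_op_le S' y01 x01; rewrite S'E linearD linearZ /= y0S -/a.
  rewrite -[_ *: (_ : R^o)]/(_ * _).
  rewrite ger0_norm; last by rewrite addr_ge0// !mulr_ge0// ltW.
  by apply: le_trans; lra.
exists x0, th; split => // z x z1 x1; rewrite !S'E !linearD !linearZ /= -/c.
rewrite -![_ *: (z (S x0) : R^o)]/(_ * _).
rewrite y0S -/a.
have -> : `|z (S x0) + h * a * z (S x0)| = (1 + h * a) * `|z (S x0)|.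
  by rewrite -[X in X + _]mul1r -mulrDl normrM ger0_norm// addr_ge0// mulr_ge0// ltW.
have := ler_normD (z (S x)) (h * y0 (S x) * z (S x0)).
rewrite !normrM (gtr0_norm h0).
have := functional_op_le S z1 x01; have := functional_op_le S z1 x1.
have := y0S_le x x1; rewrite -/M.
have := normr_ge0 (z (S x0)); have := normr_ge0 (y0 (S x)).
move=> p0 w0 pM qM wM tri big.
apply: (zizler_estimate h0 M0 th0 x0M aM _ _ qM nS'_ge nS'_le
  (lt_le_trans big tri)); rewrite ?p0 ?w0//.
Qed.

End zizler.

Definition extreme_attaining {R : realType} (X Y : normedModType R) : set 'L(X, Y) :=
  [set T : 'L(X, Y) | exists2 e : 'L(Y, R^o), extreme_point (unit_ball _) e &
    forall c : R, c < `|T| -> exists2 x, `|x| <= 1 & c < `|e (T x)|].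

Lemma exists_inv_nat_lt {R : realType} (d : R) : 0 < d -> exists n, n.+1%:R^-1 < d.
Proof.
move=> d0; have := @near_infty_natSinv_lt R (PosNum d0).
by move=> [n _ /(_ n (leqnn n))] /=; exists n.
Qed.

(** The functionals [z] of the dual ball with [|z \o T| = |T|] form a weak-* face, and every such
    face contains an extreme point. *)
Lemma zizler_sets_extreme_attaining {R : realType} (X Y : normedModType R) :
  \bigcap_n zizler_set n `<=` @extreme_attaining R X Y.
Proof.
move=> T Tz.
pose P (z : 'L(Y, R^o)) := forall c : R, c < `|T| ->
  exists2 x, `|x| <= 1 & c < `|z (T x)|.
have [x_ x_P] := @choice _ _ (fun n x => zizler_witness n T x) (fun n => Tz n I).
pose D n : set 'L(Y, R^o) := [set z | `|T| - n.+1%:R^-1 <= `|z (T (x_ n))|].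
have Dcl n : closed (D n : set (weak_star Y)) by exact: weak_star_closed_norm_ge.
(* Here goodness of all orders enters: the supremum over the ball reduces to one inequality at each
   point [x_ n], which is a weak-* closed condition. *)
have PE : [set z | `|z| <= 1 /\ P z] =
    unit_ball 'L(Y, R^o) `&` \bigcap_n D n.
  apply/seteqP; split=> z [z1 Pz]; split => //.
    move=> n _; have [d [xn d0 Hd]] := x_P n.
    have [|x x1 /(Hd z x z1 x1)] := Pz (`|T| - d); first by rewrite ltrBlDr ltrDl.
    rewrite /D /=; move: (_^-1) => c; lra.
  move=> c cT; have [n nc] : exists n, n.+1%:R^-1 < `|T| - c.
    by apply: exists_inv_nat_lt; rewrite subr_gt0.
  exists (x_ n); first by have [d []] := x_P n.
  have := Pz n I; rewrite /D /=; move: (_^-1) nc => b; lra.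
have face : weak_star_face [set z | `|z| <= 1 /\ P z].
  split.
  - have [z_ z_P] : exists z_ : nat -> 'L(Y, R^o), forall k,
        `|z_ k| <= 1 /\ exists2 x, `|x| <= 1 & `|T| - k.+1%:R^-1 < `|z_ k (T x)|.
      suff /choice[z_ z_P] : forall k, exists z : 'L(Y, R^o), `|z| <= 1 /\
        exists2 x, `|x| <= 1 & `|T| - k.+1%:R^-1 < `|z (T x)| by exists z_.
      move=> k.
      have [|x x1 Tx] := @bounded_op_norm_gt _ _ _ T (`|T| - k.+1%:R^-1).
        by rewrite ltrBlDr ltrDl.
      have [z [z1 zT]] := exists_norming_functional (T x).
      by exists z; split => //; exists x => //; rewrite zT normr_id.
    (* A weak-* cluster point of asymptotically norming functionals. For each [n], all late [z_ k]
       lie in the closed set [D n], so the cluster point does too. *)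
    have [|z [z1 clz]] := @weak_star_ball_compact R Y _
        (fmap_proper_filter (z_ : nat -> weak_star Y) eventually_filter).
      by exists 0%N => // k _; have [] := z_P k.
    exists z; rewrite PE; split => // n _.
    apply: Dcl => U zU; apply: clz zU.
    have [d [xn d0 Hd]] := x_P n.
    have := @near_infty_natSinv_lt R (PosNum d0); apply: filterS => k /= kd.
    have [zk1 [x x1 Tx]] := z_P k.
    have := Hd (z_ k) x zk1 x1; rewrite /D /=.
    move: (k.+1%:R^-1) (n.+1%:R^-1) kd Tx => b c kd Tx.
    have Tx' : `|T| - d < `|z_ k (T x)| by lra.
    move=> /(_ Tx'); lra.
  - rewrite PE; apply: closedI; first exact: weak_star_ball_closed.
    by apply: closed_bigI => n _; exact: Dcl.
  split=> [z []//|a b t a1 b1 /andP[t0 t1] [_ Pz]].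
  (* Since [g] contributes at most [(1 - s) * |T|], a deficit below [s * (|T| - c)] for the
     combination leaves a deficit below [|T| - c] for [f]. *)
  have main (f g : 'L(Y, R^o)) (s : R) : `|g| <= 1 -> 0 < s < 1 ->
      P (s *: f + (1 - s) *: g) -> P f.
    move=> g1 /andP[s0 s1] Pfg c cT.
    have [|x x1] := Pfg (`|T| - s * (`|T| - c)).
      by rewrite ltrBlDr ltrDl mulr_gt0// subr_gt0.
    rewrite bounded_opD !bounded_opZ -![_ *: (_ : R^o)]/(_ * _) => lt.
    have qM : `|g (T x)| <= `|T| by exact: functional_op_le.
    exists x => //; move: (g (T x) : R) (f (T x) : R) qM lt => q p qM lt.
    have {}lt : `|T| - s * (`|T| - c) < s * `|p| + (1 - s) * `|q|.
      apply: lt_le_trans lt (le_trans (ler_normD _ _) _).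
      by rewrite !normrM (gtr0_norm s0) (@gtr0_norm _ (1 - s)) ?subr_gt0.
    have {}qM : (1 - s) * `|q| <= (1 - s) * `|T|.
      by rewrite ler_wpM2l// subr_ge0 ltW.
    rewrite -(ltr_pM2l s0); lra.
  split; split => //.
    by apply: (main a b t b1 _ Pz); rewrite t0.
  apply: (main b a (1 - t) a1); first by rewrite subr_gt0 t1 ltrBlDr ltrDl.
  by rewrite subKr addrC.
have [e [_ Pe] ext] := weak_star_face_extreme_point face.
by exists e.
Qed.

Lemma dense_extreme_attaining {R : realType} (X : normedModType R)
  (Y : completeNormedModType R) : dense (@extreme_attaining R X Y).
Proof.
move=> O O0 oO.
have [|T [OT Tz]] := @Baire R 'L(X, Y) (@zizler_set R X Y) _ O O0 oO.
  by move=> n; split; [exact: open_zizler_set|exact: dense_zizler_set].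
by exists T; split => //; exact: zizler_sets_extreme_attaining Tz.
Qed.

(** * The space c0 *)

Section c0_coordinates.
Context {R : realType}.
Implicit Types (u v : c0 R) (n N : nat) (a : R).

Lemma c0D u v n : (u + v) n = u n + v n. Proof. by []. Qed.

Lemma c0B u v n : (u - v) n = u n - v n. Proof. by []. Qed.

Lemma c0Z a u n : (a *: u) n = a * u n. Proof. by []. Qed.

Lemma c0_coord_le u n : `|u n| <= `|u|. Proof. exact: c0_norm_ge. Qed.

Lemma c0_coord_le1 u n : `|u| <= 1 -> `|u n| <= 1.
Proof. exact: le_trans (c0_coord_le u n). Qed.

Lemma c0_normP u (M : R) : reflect (forall n, `|u n| <= M) (`|u| <= M).
Proof.
apply: (iffP idP) => [uM n|]; last exact: c0_norm_le.
exact: le_trans (c0_coord_le u n) uM.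
Qed.

Lemma c0_eq u v : (forall n, u n = v n) -> u = v.
Proof. by move=> uv; apply/val_inj/funext. Qed.

Lemma c0_intro (f : nat -> R) u N : (forall n, (N <= n)%N -> f n = u n) ->
  exists v : c0 R, forall n, v n = f n.
Proof.
move=> fu; have fP : (f : nat -> R^o) \in @c0_pred R.
  apply/asboolP; apply: cvg_trans (c0_cvg u); apply: near_eq_cvg.
  by exists N => // n /= Nn; rewrite fu.
by exists (C0 fP).
Qed.

Lemma c0_sumE N (F : 'I_N -> c0 R) n :
  (\sum_(i < N) F i) n = \sum_(i < N) F i n.
Proof. by elim/big_ind2 : _ => // u x v y <- <-. Qed.

Definition c0_basis_seq (i : nat) : nat -> R^o := fun n => (n == i)%:R.

Lemma c0_basis_seqP i : c0_basis_seq i \in @c0_pred R.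
Proof.
apply/asboolP; apply: cvg_trans (@c0_cvg R 0); apply: near_eq_cvg.
by exists i.+1 => // n /= ni; rewrite /c0_basis_seq gtn_eqF.
Qed.

Definition c0_basis i : c0 R := C0 (c0_basis_seqP i).

Lemma c0_basisE i n : c0_basis i n = (n == i)%:R. Proof. by []. Qed.

Lemma c0_basis_norm i : `|c0_basis i| = 1.
Proof.
apply/eqP; rewrite eq_le; apply/andP; split.
  by apply/c0_normP => n; rewrite c0_basisE; case: eqP => _; rewrite ?normr1 ?normr0.
by have := c0_coord_le (c0_basis i) i; rewrite c0_basisE eqxx normr1.
Qed.

Lemma c0_sum_basisE N (c : nat -> R) n :
  (\sum_(i < N) c i *: c0_basis i) n = if (n < N)%N then c n else 0.
Proof.
rewrite c0_sumE (eq_bigr (fun i : 'I_N => c i * (n == i)%:R))//.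
case: ifPn => nN; last first.
  rewrite big1// => i _; rewrite gtn_eqF ?mulr0//.
  by rewrite (leq_trans (ltn_ord i))// leqNgt.
rewrite (bigD1 (Ordinal nN))//= eqxx mulr1 big1 ?addr0// => i ni.
case: eqP => [nE|_]; last by rewrite mulr0.
by case/eqP: ni; apply/val_inj.
Qed.

Lemma linear_c0_sum_basis (Y : lmodType R) (f : {linear c0 R -> Y}) N (c : nat -> R) :
  f (\sum_(i < N) c i *: c0_basis i) = \sum_(i < N) c i *: f (c0_basis i).
Proof. by rewrite linear_sum; apply: eq_bigr => i _; rewrite linearZ. Qed.

Lemma c0_sub_finite u v N : (forall n, (N <= n)%N -> u n = v n) ->
  u - v = \sum_(i < N) (u i - v i) *: c0_basis i.
Proof.
move=> uv; apply: c0_eq => n.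
rewrite (c0_sum_basisE N (fun i => u i - v i)) c0B.
by case: ltnP => // /uv ->; rewrite subrr.
Qed.

Lemma c0_tail_le u (e : R) : 0 < e ->
  exists N, `|u - \sum_(i < N) u i *: c0_basis i| <= e.
Proof.
move=> e0; have /cvgr0Pnorm_le/(_ _ e0)[N _ uN] := c0_cvg u.
exists N; apply/c0_normP => n; rewrite c0B c0_sum_basisE.
case: ltnP => nN; first by rewrite subrr normr0 ltW.
by rewrite subr0; exact: uN.
Qed.

End c0_coordinates.

(** * Operators with a finitely supported dominating functional *)

Lemma exists_pos_le_nonzero {R : realType} (a : nat -> R) N :
  exists2 c : R, 0 < c & forall i, (i < N)%N -> a i != 0 -> c <= `|a i|.
Proof.
elim: N => [|N [c c0 ca]]; first by exists 1.
have [aN|aN] := eqVneq (a N) 0.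
  by exists c => // i; rewrite ltnS leq_eqVlt => /orP[/eqP ->|/ca//]; rewrite aN eqxx.
exists (Num.min c `|a N|); first by rewrite lt_min c0 normr_gt0.
move=> i; rewrite ltnS leq_eqVlt => /orP[/eqP -> _|iN ai].
  by rewrite ge_min lexx orbT.
by rewrite ge_min ca.
Qed.

(** The right side minus the left is [(Num.sg a - x) * (a - l * b)], and neither factor has sign
    opposite to that of [a]. *)
Lemma sign_perturbation_le (R : realFieldType) (x a l b : R) : a != 0 -> `|x| <= 1 ->
  0 < l -> l * `|b| <= `|a| -> x * a + l * ((Num.sg a - x) * b) <= `|a|.
Proof.
move=> a0 x1 l0 lb.
rewrite -subr_ge0 {1}[`|a|]normrEsg.
have -> : Num.sg a * a - (x * a + l * ((Num.sg a - x) * b)) =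
  (Num.sg a - x) * (a - l * b) by ring.
move: x1 lb; rewrite -{1}(gtr0_norm l0) -normrM !ler_norml => /andP[xl xr] /andP[bl br].
move: a0 bl br; case: sgrP => // [a0|a0] _ bl br.
  by rewrite mulr_ge0// subr_ge0.
by rewrite -mulrNN mulr_ge0//; lra.
Qed.

(** The zero is at [t = q / (q - p)]; expanding the fraction by [p] makes its denominator visibly
    positive. *)
Lemma opposite_signs_convex_zero (R : realFieldType) (p q : R) :
  p != 0 -> p * q <= 0 -> exists2 t, 0 <= t <= 1 & t * p + (1 - t) * q = 0.
Proof.
move=> p0 pq.
have d0 : 0 < p ^+ 2 - p * q by rewrite subr_gt0 (le_lt_trans pq)// exprn_even_gt0.
exists (- (p * q) / (p ^+ 2 - p * q)).
  rewrite divr_ge0 ?(ltW d0) ?oppr_ge0//= ler_pdivrMr// mul1r.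
  by rewrite lerDr sqr_ge0.
by field; rewrite gt_eqF.
Qed.

Section finitely_supported_maximum.
Context {R : realType} (Y : normedModType R) (A : set 'L(Y, R^o)).
Hypothesis A1 : forall z, A z -> `|z| <= 1.
Hypothesis A_norming : forall (y : Y) (c : R),
  (forall z, A z -> `|z y| <= c) -> `|y| <= c.
Variables (T : 'L(c0 R, Y)) (w : 'L(Y, R^o)) (N : nat) (a : nat -> R) (r : R).
Hypothesis Aw : A w.
Hypothesis wT : forall x, w (T x) = \sum_(i < N) x i * a i.
Let m := \sum_(i < N) `|a i|.
Hypothesis m_gt0 : 0 < m.
Hypothesis r_lt : r < m.
Hypothesis T_other : forall z x, A z -> z <> w -> `|x| <= 1 -> `|z (T x)| <= r.

Let w_le x : `|x| <= 1 -> `|w (T x)| <= m.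
Proof.
move=> x1; rewrite wT (le_trans (ler_norm_sum _ _ _))// ler_sum// => i _.
by rewrite normrM ler_piMl// c0_coord_le1.
Qed.

Let T_norm_le : `|T| <= m.
Proof.
apply/bounded_op_normP => x x1; apply: A_norming => z Az.
have [->|zw] := pselect (z = w); first exact: w_le.
exact: le_trans (T_other Az zw x1) (ltW r_lt).
Qed.

(** Moves [x] onto the face [w (T x) = m] by changing only the coordinates on which [w \o T]
    depends. *)
Let patch (x : c0 R) : exists x' : c0 R, forall n,
  x' n = if (n < N)%N && (a n != 0) then Num.sg (a n) else x n.
Proof. by apply: (@c0_intro _ _ x N) => n Nn; rewrite ltnNge Nn. Qed.

Let patch_le (x x' : c0 R) : (forall n,
    x' n = if (n < N)%N && (a n != 0) then Num.sg (a n) else x n) ->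
  `|x| <= 1 -> `|x'| <= 1 /\ w (T x') = m.
Proof.
move=> x'E x1; split.
  apply/c0_normP => n; rewrite x'E; case: ifP => _; last exact: c0_coord_le1.
  by rewrite normr_sg; case: (a n == 0).
rewrite wT; apply: eq_bigr => i _; rewrite x'E ltn_ord/=.
by case: eqVneq => [->|_] /=; rewrite ?mulr0 ?normr0// normrEsg.
Qed.

Let attains (x : c0 R) : `|x| <= 1 -> w (T x) = m -> norm_attaining_set T x.
Proof.
move=> x1 wTx.
have mT : m <= `|T x|.
  rewrite -[m]ger0_norm ?(ltW m_gt0)// -wTx.
  by apply: le_trans (bounded_opP w _) _; rewrite ler_piMl// A1.
have Tx := bounded_opP T x.
have T0 : 0 < `|T| by rewrite (lt_le_trans m_gt0)// (le_trans mT) ?bounded_op1P.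
split.
  apply/eqP; rewrite eq_le x1 -(ler_pM2l T0) mulr1.
  exact: le_trans T_norm_le (le_trans mT Tx).
by apply/eqP; rewrite eq_le bounded_op1P//= (le_trans T_norm_le).
Qed.

(* Each coordinate moved off the face [w (T x) = m] costs [w (T x)] a multiple
   of [`|a i|], which for small [l] absorbs what [- l * w (S x)] can gain. *)
Let not_strong_orth (S : 'L(c0 R, Y)) :
  (forall x, `|x| <= 1 -> w (T x) = m -> 0 < w (S x)) ->
  ~ strong_birkhoff_orth T S.
Proof.
move=> Spos TS.
have [c c_gt0 ca] := exists_pos_le_nonzero a N.
pose K := `|S| + 1; have K0 : 0 < K by rewrite ltr_wpDl.
(* The first bound allows the coordinatewise estimate for [w]; the second keeps the other
   functionals of [A] below [r + (m - r) = m]. *)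
pose l := Num.min (c / K) ((m - r) / K).
have l0 : 0 < l by rewrite lt_min !divr_gt0// subr_gt0.
have lS_le b : 0 <= b -> b <= `|S| -> l * b <= c /\ l * b <= m - r.
  move=> b0 bS.
  have bK : b <= K by rewrite (le_trans bS)// lerDl.
  split; apply: (@le_trans _ _ (l * K)); rewrite ?ler_wpM2l ?(ltW l0)//.
    by rewrite -ler_pdivlMr// ge_min lexx.
  by rewrite -ler_pdivlMr// ge_min lexx orbT.
have wS_le x : `|x| <= 1 -> `|w (S x)| <= `|S|.
  by move=> x1; apply: functional_op_le => //; exact: A1.
have half x : `|x| <= 1 -> w (T x) - l * w (S x) <= m.
  move=> x1; have [x' x'E] := patch x; have [x'1 wTx'] := patch_le x'E x1.
  have wSx' := Spos _ x'1 wTx'.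
  have : x' - x = \sum_(i < N) (x' i - x i) *: c0_basis i.
    by apply: c0_sub_finite => n Nn; rewrite x'E ltnNge Nn.
  move=> /(congr1 (fun u => w (S u))).
  rewrite !linearB/= linear_sum linear_sum/= => wSE.
  have {}wSE : w (S x) = w (S x') - \sum_(i < N) (x' i - x i) * w (S (c0_basis i)).
    have -> : \sum_(i < N) (x' i - x i) * w (S (c0_basis i)) = w (S x') - w (S x).
      by rewrite wSE; apply: eq_bigr => i _; rewrite !linearZ.
    by rewrite subKr.
  (* The positive number [w (S x')] is dropped; what remains is a finite sum, bounded term by term
     by [|a i|]. *)
  apply: (@le_trans _ _ (\sum_(i < N)
      (x i * a i + l * ((x' i - x i) * w (S (c0_basis i)))))).
    rewrite big_split/= -mulr_sumr -wT wSE mulrBr opprB lerD2l.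
    by rewrite gerBl mulr_ge0// ltW.
  apply: ler_sum => i _; rewrite x'E ltn_ord/=.
  have [ai|ai] := eqVneq (a i) 0; first by rewrite ai mulr0 subrr mul0r mulr0 addr0 normr0.
  have [||lb _] := lS_le `|w (S (c0_basis i))|; [exact: normr_ge0| |].
    by apply: wS_le; rewrite c0_basis_norm.
  apply: sign_perturbation_le => //; first exact: c0_coord_le1.
  exact: le_trans lb (ca i (ltn_ord i) ai).
have : `|T - l *: S| <= m.
  apply/bounded_op_normP => x x1; apply: A_norming => z Az.
  rewrite bounded_opB bounded_opZ linearB linearZ/= -[_ *: (_ : R^o)]/(_ * _).
  have [->|zw] := pselect (z = w).
    rewrite ler_norml half// andbT lerNl opprB.
    have := half (- x); rewrite normrN => /(_ x1).
    by rewrite !linearN/= mulrN opprK addrC.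
  apply: le_trans (ler_normB _ _) _.
  have Tzx := T_other Az zw x1.
  have Szx : `|z (S x)| <= `|S| by apply: functional_op_le => //; exact: A1.
  have [_ lSz] := lS_le _ (normr_ge0 (z (S x))) Szx.
  rewrite normrM (gtr0_norm l0).
  by apply: le_trans (lerD Tzx lSz) _; rewrite addrC subrK.
(* Strong orthogonality would give [|T| < |T - l *: S| <= m], while a patched point shows
   [m <= |T|]. *)
have := TS (- l); rewrite oppr_eq0 gt_eqF// scaleNr => /(_ isT).
have [x0 x0E] := patch 0.
have [|x01 wTx0] := patch_le x0E; first by rewrite normr0.
have [_ <-] := attains x01 wTx0 => lt1 lt2.
have := lt_le_trans lt1 lt2; rewrite ltNge => /negP; apply.
rewrite -[m]ger0_norm ?(ltW m_gt0)// -wTx0.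
by apply: le_trans (bounded_opP w _) _; rewrite ler_piMl// A1.
Qed.

Lemma finitely_supported_BSa : BSa (c0 R) Y T.
Proof.
have [x0 x0E] := patch 0.
have [|x01 wTx0] := patch_le x0E; first by rewrite normr0.
split; first by exists x0; exact: attains.
move=> S TS; apply: contrapT => noX.
have wS_neq0 x : `|x| <= 1 -> w (T x) = m -> w (S x) != 0.
  move=> x1 wTx; apply/eqP => wSx; apply: noX.
  have [xS Tx] := attains x1 wTx; exists x => // t.
  rewrite Tx; apply: le_trans T_norm_le _.
  rewrite -[m]ger0_norm ?(ltW m_gt0)//.
  have -> : m = w (T x + t *: S x).
    by rewrite linearD linearZ/= wSx -[_ *: (_ : R^o)]/(_ * _) mulr0 addr0.
  by apply: le_trans (bounded_opP w _) _; rewrite ler_piMl// A1.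
(* The face is convex, so values of [w \o S] of opposite signs would produce a zero on the segment
   joining the two points. *)
have same_sign x : `|x| <= 1 -> w (T x) = m -> 0 < w (S x) * w (S x0).
  move=> x1 wTx; rewrite ltNge; apply/negP => opp.
  have [t /andP[t0 t1] tw] := opposite_signs_convex_zero (wS_neq0 x x1 wTx) opp.
  pose u := t *: x + (1 - t) *: x0.
  have u1 : `|u| <= 1.
    apply: le_trans (ler_normD _ _) _.
    by rewrite !normrZ (ger0_norm t0) (@ger0_norm _ (1 - t)) ?subr_ge0//; nra.
  have wTu : w (T u) = m.
    rewrite !linearD !linearZ/= wTx wTx0 -![_ *: (_ : R^o)]/(_ * _); ring.
  have wSu : w (S u) = 0 by rewrite !linearD !linearZ.
  by have := wS_neq0 u u1 wTu; rewrite wSu eqxx.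
have [wSx0|wSx0|wSx0] := ltgtP (w (S x0) : R) 0.
- have : strong_birkhoff_orth T (- S).
    by move=> t t0; rewrite scalerN -scaleNr; apply: TS; rewrite oppr_eq0.
  apply: not_strong_orth => x x1 wTx; rewrite -[(- S) x]/(- S x) linearN/= oppr_gt0.
  by have := same_sign x x1 wTx; rewrite nmulr_lgt0.
- move: TS; apply: not_strong_orth => x x1 wTx.
  by have := same_sign x x1 wTx; rewrite pmulr_lgt0.
by have := wS_neq0 x0 x01 wTx0; rewrite wSx0 eqxx.
Qed.

End finitely_supported_maximum.

(** * Density *)

(** The bound is made nonnegative by a maximum with 0; a supremum equal to [-oo] occurs only for
    empty [B], where 0 serves. *)
Lemma ereal_sup_lt1_real {R : realType} (T : Type) (B : set T) (rho : T -> R) :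
  (ereal_sup [set (rho f)%:E | f in B] < 1)%E ->
  exists2 r : R, 0 <= r < 1 & forall f, B f -> rho f <= r.
Proof.
set s := ereal_sup _ => s1.
have rho_le f : B f -> ((rho f)%:E <= s)%E.
  by move=> Bf; apply: ereal_sup_ubound; exists f.
case: s s1 rho_le => [s|//|] s1 rho_le.
  exists (Num.max 0 s); first by rewrite le_max lexx gt_max ltr01/= -lte_fin.
  by move=> f /rho_le; rewrite lee_fin le_max => ->; rewrite orbT.
by exists 0 => [|f /rho_le]; rewrite ?lexx ?ltr01// leeNy_eq.
Qed.

Lemma bounded_op_rank_one {R : realType} (X Y : normedModType R)
    (f : 'L(X, R^o)) (y : Y) :
  exists U : 'L(X, Y), forall x, U x = (f x : R) *: y.
Proof.
apply: (@bounded_op_intro _ _ _ _ (`|f| * `|y|)) => [c x x'|x].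
  by rewrite linearP scalerDl scalerA.
by rewrite normrZ mulrAC ler_wpM2r//; exact: bounded_opP.
Qed.

(** * Truncation of functionals on c0 *)

Section truncation.
Context {R : realType} (f : 'L(c0 R, R^o)).
Let f_ i : R := f (c0_basis i).

Lemma truncation_exists N :
  exists g : 'L(c0 R, R^o), forall x, g x = \sum_(i < N) x i * f_ i.
Proof.
apply: (@bounded_op_intro _ _ _ _ (\sum_(i < N) `|f_ i|)) => [c x y|x].
  rewrite scaler_sumr -big_split /=; apply: eq_bigr => i _.
  by change ((c * x i + y i) * f_ i = c * (x i * f_ i) + y i * f_ i); ring.
apply: le_trans (ler_norm_sum _ _ _) _; rewrite mulr_suml ler_sum// => i _.
by rewrite normrM mulrC ler_wpM2l// c0_coord_le.
Qed.

(** Evaluate [f] at the point with the signs of [f_ i] on the first [N] coordinates and [x] or [- x]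
    on the others: head and tail add up to at most [|f|]. *)
Lemma functional_truncation_le N (x : c0 R) : `|x| <= 1 ->
  `|\sum_(i < N) x i * f_ i - f x| <= `|f| - \sum_(i < N) `|f_ i|.
Proof.
move=> x1.
have fx : \sum_(i < N) x i * f_ i = f (\sum_(i < N) x i *: c0_basis i).
  by rewrite linear_c0_sum_basis.
have main (t : R) : `|t| = 1 ->
    \sum_(i < N) `|f_ i| + t * (f x - \sum_(i < N) x i * f_ i) <= `|f|.
  move=> t1.
  pose x' := \sum_(i < N) Num.sg (f_ i) *: c0_basis i +
    t *: (x - \sum_(i < N) x i *: c0_basis i).
  have x'1 : `|x'| <= 1.
    apply/c0_normP => n.
    rewrite c0D c0Z c0B (c0_sum_basisE N (fun i => Num.sg (f_ i))) c0_sum_basisE.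
    case: ifP => _; last by rewrite add0r subr0 normrM t1 mul1r c0_coord_le1.
    by rewrite subrr mulr0 addr0 normr_sg; case: eqP.
  have := bounded_op1P f x'1; apply: le_trans; apply: le_trans (ler_norm _).
  rewrite linearD linearZ/= linearB/= -fx -[_ *: (_ : R^o)]/(_ * _).
  rewrite (linear_c0_sum_basis f N (fun i => Num.sg (f_ i))) lerD2r.
  by apply: ler_sum => i _; rewrite normrEsg.
have := main 1 (normr1 _); have := main (-1) (normrN1 _).
rewrite ler_norml mulN1r mul1r; move: (\sum_(i < N) x i * f_ i) (f x : R) => b c.
by move=> ? ?; apply/andP; split; lra.
Qed.

Lemma functional_truncation_gt (c : R) : c < `|f| ->
  exists N, c < \sum_(i < N) `|f_ i|.
Proof.
move=> cf; have [x x1 cx] := bounded_op_norm_gt cf.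
have K0 : 0 < `|f| + 1 by rewrite ltr_wpDl.
have [|N Nx] := @c0_tail_le _ x ((`|f x| - c) / (`|f| + 1) / 2).
  by rewrite !divr_gt0// subr_gt0.
exists N; apply: (@lt_le_trans _ _ `|f (\sum_(i < N) x i *: c0_basis i)|).
  have tail : `|f (x - \sum_(i < N) x i *: c0_basis i)| < `|f x| - c.
    apply: le_lt_trans (bounded_opP f _) _.
    apply: (@le_lt_trans _ _ ((`|f| + 1) * ((`|f x| - c) / (`|f| + 1) / 2))).
      by rewrite ler_pM// lerDl.
    move: (`|f| + 1) K0 (`|f x|) cx => K K0 p cp.
    have -> : K * ((p - c) / K / 2) = (p - c) / 2 by field; rewrite gt_eqF.
    lra.
  have := ler_normD (f (x - \sum_(i < N) x i *: c0_basis i))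
    (f (\sum_(i < N) x i *: c0_basis i)).
  by rewrite -linearD subrK; lra.
rewrite linear_c0_sum_basis; apply: le_trans (ler_norm_sum _ _ _) _; apply: ler_sum => i _.
by rewrite -[_ *: (_ : R^o)]/(_ * _) normrM ler_piMl// c0_coord_le1.
Qed.

End truncation.

Lemma zero_op_BSa {R : realType} (Y : normedModType R) : BSa (c0 R) Y 0.
Proof.
have attains : norm_attaining_set (0 : 'L(c0 R, Y)) (c0_basis 0).
  by split; [exact: c0_basis_norm|rewrite [LHS]normr0 normr0].
split; first by exists (c0_basis 0).
by move=> S _; exists (c0_basis 0) => // t; rewrite [leLHS]normr0.
Qed.

Section density.
Context {R : realType} (Y : completeNormedModType R).

(** Some extreme point of the dual ball norms [y], and up to sign it is a weak-* limit of elements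
    of [A]. *)
Lemma quasi_beta_norming (A : set 'L(Y, R^o)) :
  (forall e, extreme_point (unit_ball 'L(Y, R^o)) e ->
    exists (Ae : set 'L(Y, R^o)) (t : R),
    [/\ Ae `<=` A, `|t| = 1 & closure (Ae : set (weak_star Y)) (t *: e)]) ->
  forall (y : Y) (c : R), (forall z, A z -> `|z y| <= c) -> `|y| <= c.
Proof.
move=> Aext y c Ac; have [e ext ey] := exists_norming_extreme_point y.
have [Ae [t [AeA t1 clAe]]] := Aext e ext.
have := weak_star_closure_norm_le (fun z Aez => Ac z (AeA z Aez)) clAe.
by rewrite bounded_opZ ey normrM t1 mul1r normr_id.
Qed.

(* The rank-one correction along [sigma w] makes [w \o T'] equal to a multiple
   of a truncation of [w \o T] that dominates all other functionals of [A]. *)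
Lemma extreme_attaining_approx (T : 'L(c0 R, Y)) (eps : R) : quasi_beta Y ->
  extreme_attaining T -> 0 < eps ->
  exists2 T', BSa (c0 R) Y T' & `|T' - T| < eps.
Proof.
move=> [A [sigma [rho [A_sphere sigma1 A_sigma rho_lt A_ext]]]] [e ext eT] eps0.
have A1 z : A z -> `|z| <= 1 by move=> /A_sphere; rewrite /unit_sphere/= => ->.
have A_norming : forall (y : Y) (c : R), (forall z, A z -> `|z y| <= c) -> `|y| <= c.
  apply: quasi_beta_norming => f /A_ext[Af [t [AfA t1 clAf _]]].
  by exists Af, t.
have [T0|Tneq0] := eqVneq `|T| 0.
  exists 0; first exact: zero_op_BSa.
  by rewrite sub0r normrN T0.
pose M := `|T|; have M0 : 0 < M by rewrite lt_neqAle eq_sym Tneq0 normr_ge0.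
have [Ae [t [AeA t1 clAe rho_sup]]] := A_ext e ext.
have [r /andP[r0 r1] rho_r] := ereal_sup_lt1_real rho_sup.
pose h := eps / (2 * M); have h0 : 0 < h by rewrite divr_gt0// mulr_gt0.
have hM : h * M = eps / 2 by rewrite /h; field; rewrite gt_eqF.
clearbody h.
(* Small enough that [M + (d + h * M) * r < (1 + h) * (M - d)]. Because [r] bounds [rho] on all of
   [Ae], [d] can be fixed before [w] is chosen. *)
pose d := h * M * (1 - r) / (4 + 2 * h).
have h4 : 0 < 4 + 2 * h by lra.
have d0 : 0 < d by rewrite !divr_gt0// !mulr_gt0// subr_gt0.
have dE : d * (4 + 2 * h) = h * M * (1 - r) by rewrite /d divfK// gt_eqF.
clearbody d.
have d_le : d <= h * M / 4.
  rewrite ler_pdivlMr//; have : h * M * (1 - r) <= h * M.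
    by rewrite ler_piMr ?mulr_ge0 ?(ltW h0) ?(ltW M0)//; lra.
  have : 0 < d * h by rewrite mulr_gt0.
  lra.
have [x x1 xe] : exists2 x, `|x| <= 1 & M - d < `|e (T x)|.
  by apply: eT; rewrite ltrBlDr ltrDl.
(* Otherwise the weak-* closed condition [|z (T x)| <= M - d] would pass from [Ae] to [t *: e]. *)
have [w Aew wx] : exists2 w, Ae w & M - d < `|w (T x)|.
  apply: contrapT => noW.
  have /weak_star_closure_norm_le/(_ clAe) : forall z, Ae z -> `|z (T x)| <= M - d.
    by move=> z Aez; rewrite leNgt; apply/negP => lt; apply: noW; exists z.
  by rewrite bounded_opZ normrM t1 mul1r leNgt xe.
have Aw := AeA w Aew.
have [f fE] := bounded_op_comp w T.
have fM : `|f| <= M.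
  by apply/bounded_op_normP => u u1; rewrite fE functional_op_le// A1.
have [N G_gt] : exists N, M - d < \sum_(i < N) `|f (c0_basis i)|.
  by apply: functional_truncation_gt; apply: (lt_le_trans wx);
    rewrite -fE bounded_op1P.
have [g gE] := truncation_exists f N.
set G := \sum_(i < N) _ in G_gt.
have gG u : `|u| <= 1 -> `|g u| <= G.
  move=> u1; rewrite gE; apply: le_trans (ler_norm_sum _ _ _) _.
  by apply: ler_sum => i _; rewrite normrM ler_piMl// c0_coord_le1.
have fg u : `|u| <= 1 -> `|g u - f u : R| <= d.
  move=> u1; rewrite gE; apply: le_trans (functional_truncation_le f N u1) _.
  by rewrite -/G; lra.
have GM : G <= M.
  have := functional_truncation_le f N (x := 0); rewrite normr0 => /(_ ler01).
  by move=> /(le_trans (normr_ge0 _)); rewrite subr_ge0 -/G => /le_trans; apply.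
(* Since [w (sigma w) = 1], adding [phi] along [sigma w] turns [w \o T = f] into [(1 + h) *: g]. *)
have [phi phiE] : exists phi : 'L(c0 R, R^o), forall u, phi u = (1 + h) * g u - f u.
  by exists ((1 + h) *: g - f).
have phi_le u : `|u| <= 1 -> `|phi u| <= d + h * M.
  move=> u1; have -> : phi u = (g u - f u) + h * g u :> R by rewrite phiE; ring.
  apply: le_trans (ler_normD _ _) _; apply: lerD; first exact: fg.
  rewrite normrM gtr0_norm// ler_wpM2l ?(ltW h0)//.
  exact: le_trans (gG u u1) GM.
have [U UE] := bounded_op_rank_one phi (sigma w).
exists (T + U); last first.
  rewrite addrC addKr; apply: (@le_lt_trans _ _ (d + h * M)).
    apply/bounded_op_normP => u u1; rewrite UE normrZ sigma1// mulr1.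
    exact: phi_le.
  by lra.
have mE : \sum_(i < N) `|(1 + h) * f (c0_basis i) : R| = (1 + h) * G.
  rewrite /G mulr_sumr; apply: eq_bigr => i _; rewrite normrM gtr0_norm//; lra.
have rG : M + (d + h * M) * r < (1 + h) * G.
  apply: (@lt_trans _ _ ((1 + h) * (M - d))); last by rewrite ltr_pM2l//; lra.
  have : d * r <= d by rewrite ler_piMr ?(ltW d0)// ltW.
  have : 0 < d * h by rewrite mulr_gt0.
  have -> : (1 + h) * (M - d) = M - d + h * M - d * h by ring.
  lra.
apply: (@finitely_supported_BSa R Y A A1 A_norming (T + U) w N
  (fun i => (1 + h) * f (c0_basis i)) (M + (d + h * M) * r) Aw).
- move=> u; rewrite bounded_opD UE linearD linearZ/= A_sigma// -fE phiE.
  rewrite -[_ *: (_ : R^o)]/(_ * _) mulr1 addrC subrK gE mulr_sumr.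
  by apply: eq_bigr => i _; rewrite mulrCA.
- rewrite mE; apply: le_lt_trans rG; rewrite addr_ge0 ?(ltW M0)//.
  by rewrite mulr_ge0// addr_ge0 ?(ltW d0)// mulr_ge0// ltW.
- by rewrite mE.
move=> z u Az zw u1; rewrite bounded_opD UE linearD linearZ/=.
apply: le_trans (ler_normD _ _) _; apply: lerD.
  by apply: functional_op_le => //; exact: A1.
rewrite normrM ler_pM//; first exact: phi_le.
have [zs _] := rho_lt w z Aw Az (fun wz => zw (esym wz)).
exact: le_trans zs (rho_r w Aew).
Qed.

Lemma dense_BSa : quasi_beta Y -> dense (BSa (c0 R) Y).
Proof.
move=> qb O O0 oO.
have [T [OT extT]] := dense_extreme_attaining O0 oO.
have /nbhs_ballP[eps /= eps0 ballO] : nbhs T O by apply: open_nbhs_nbhs.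
have [T' BT' T'T] := extreme_attaining_approx qb extT eps0.
exists T'; split => //; apply: ballO.
by change (`|T - T'| < eps); rewrite distrC.
Qed.

End density.

(** * Property quasi-beta of c0 *)

Section c0_quasi_beta.
Context {R : realType}.

Lemma c0_coord_mem i : (fun u : c0 R => u i) \in @bounded_op_pred R (c0 R) R^o.
Proof.
apply/asboolP; split; first by move=> a u v.
by exists 1 => u; rewrite mul1r; exact: c0_coord_le.
Qed.

Definition c0_coord i : 'L(c0 R, R^o) := BoundedOp (c0_coord_mem i).

Lemma c0_coordE i u : c0_coord i u = u i. Proof. by []. Qed.

Lemma c0_coord_norm i : `|c0_coord i| = 1.
Proof.
apply/eqP; rewrite eq_le; apply/andP; split.
  by apply/bounded_op_normP => u u1; rewrite c0_coordE c0_coord_le1.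
have := bounded_op1P (c0_coord i) (x := c0_basis i).
by rewrite c0_basis_norm c0_coordE c0_basisE eqxx normr1; exact.
Qed.

(* The smallest [i] with [e (c0_basis i) != 0] splits [e] as an l1-sum of a
   multiple of a coordinate and a remainder. *)
Lemma c0_extreme_point (e : 'L(c0 R, R^o)) :
  extreme_point (unit_ball 'L(c0 R, R^o)) e ->
  exists i (s : R), `|s| = 1 /\ e = s *: c0_coord i.
Proof.
move=> [e1 ext].
have [i0 ei0] : exists i, e (c0_basis i) != 0.
  apply: contrapT => no_i.
  have e_eq0 i : e (c0_basis i) = 0.
    by apply/eqP; apply: contrapT => /negP ei; apply: no_i; exists i.
  have e0 : e = 0.
    apply/eqP; rewrite -normr_eq0 eq_le normr_ge0 andbT leNgt; apply/negP.
    move=> /functional_truncation_gt[N]; rewrite big1 ?ltxx// => j _.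
    by rewrite e_eq0 normr0.
  (* The zero functional is the midpoint of two opposite coordinates, hence not extreme. *)
  have [||||c0e _] := ext (c0_coord 0) (- c0_coord 0) 2^-1.
  - by rewrite /unit_ball/= c0_coord_norm.
  - by rewrite /unit_ball/= normrN c0_coord_norm.
  - by apply/andP; split; lra.
  - rewrite e0 scalerN -scalerBl (_ : 2^-1 - (1 - 2^-1) = 0) ?scale0r//; lra.
  have := c0_coord_norm 0; rewrite c0e e0 normr0 => /esym/eqP.
  by rewrite oner_eq0.
have [i ei imin] := ex_minnP (ex_intro (fun i => e (c0_basis i) != 0) i0 ei0).
pose p : R := e (c0_basis i).
have small (j : 'I_i) : e (c0_basis j) = 0.
  by apply/eqP; apply: contraTT (ltn_ord j) => /imin; rewrite -leqNgt.
(* The truncation of [e] after coordinate [i] is exactly [p *: c0_coord i], by minimality of [i]. *)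
have rest : `|e - p *: c0_coord i| <= 1 - `|p|.
  apply/bounded_op_normP => u u1; rewrite bounded_opB bounded_opZ c0_coordE.
  have := functional_truncation_le e i.+1 u1.
  rewrite !big_ord_recr/= !big1 => [|j _|j _]; rewrite ?small ?mulr0 ?normr0//.
  rewrite !add0r -/p distrC [p *: _]mulrC => /le_trans; apply.
  by rewrite lerD2r.
exists i, (Num.sg p); split; first by rewrite normr_sg ei.
have p0 : 0 < `|p| by rewrite normr_gt0.
have [p1|p1] := ltP `|p| 1; last first.
  have : `|e - p *: c0_coord i| = 0.
    by apply/eqP; rewrite eq_le normr_ge0 andbT (le_trans rest)// subr_le0.
  move=> /normr0_eq0/eqP; rewrite subr_eq0 => /eqP {1}->.
  congr (_ *: _); rewrite [LHS]numEsg.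
  have -> : `|p| = 1; last by rewrite mulr1.
  apply/eqP; rewrite eq_le p1 andbT.
  by have := normr_ge0 (e - p *: c0_coord i); lra.
have q0 : 0 < 1 - `|p| by rewrite subr_gt0.
(* If [|p| < 1], the remainder divided by [1 - |p|] lies in the ball, and [e] is a proper convex
   combination of it and the signed coordinate. *)
have [||||-> //] := ext (Num.sg p *: c0_coord i)
  ((1 - `|p|)^-1 *: (e - p *: c0_coord i)) `|p|.
- by rewrite /unit_ball/= normrZ c0_coord_norm mulr1 normr_sg ei.
- rewrite /unit_ball/= normrZ gtr0_norm ?invr_gt0//.
  by rewrite mulrC ler_pdivrMr// mul1r.
- by rewrite p0.
by rewrite !scalerA mulfV ?gt_eqF// scale1r [`|p| * _]mulrC -numEsg addrC subrK.
Qed.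

(** The coordinate functionals are biorthogonal to the unit vectors, so [rho = 0] works, and up to
    sign every extreme point is itself a coordinate. *)
Lemma c0_quasi_beta : quasi_beta (c0 R).
Proof.
(* A chosen index, with default 0 outside the coordinates. It suffices that the chosen index gives
   the same functional. *)
pose index (f : 'L(c0 R, R^o)) := xget 0%N [set i | f = c0_coord i].
have indexP i : c0_coord i = c0_coord (index (c0_coord i)).
  by rewrite /index; case: xgetP => [j _ ->//|/(_ i)]; case.
exists (range c0_coord), (fun f => c0_basis (index f)), (fun=> 0); split.
- by move=> _ [i _ <-]; exact: c0_coord_norm.
- by move=> f _; exact: c0_basis_norm.
- by move=> _ [i _ <-]; rewrite {1}indexP c0_coordE c0_basisE eqxx.
- move=> _ _ [i _ <-] [j _ <-] ij; split; last exact: ltr01.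
  rewrite c0_coordE c0_basisE; case: eqP => [jE|_]; last by rewrite normr0.
  by case: ij; rewrite indexP -jE.
move=> e /c0_extreme_point[i [s [s1 ->]]].
exists [set c0_coord i], s; split=> //.
- by move=> _ ->; exists i.
- rewrite scalerA; have -> : s * s = 1.
    by rewrite -expr2 -real_normK ?num_real// s1 expr1n.
  by rewrite scale1r; exact: subset_closure.
by rewrite image_set1 ereal_sup1 lte_fin ltr01.
Qed.

End c0_quasi_beta.

Theorem corollary2p11 (R : realType) :
  (forall Y : completeNormedModType R, quasi_beta Y -> dense (BSa (c0 R) Y)) /\
  dense (BSa (c0 R) (c0 R)).
Proof.
split=> [Y qb|]; first exact: dense_BSa qb.
exact: (@dense_BSa R (c0 R) c0_quasi_beta).
Qed.
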